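(* Let $p=yu+z^2$, $v=xz+yp$, $w=x^2u-2xzp-yp^2$ in $\mathbb{C}[x][y,z,u]$, and let $c$ be an additional indeterminate. For any of the following polynomials $P_i\in\mathbb{C}[x,c]$, put $\tilde R_i:=\mathbb{C}[x,c]/(P_i)$: 1. $P_1 := x-x_0$ (where $x_0\in\mathbb{C}$); 2. $P_2 := c-c_0$ (where $c_0\in\mathbb{C}$); 3. $P_3 := x^2-c^3$. Then for each $i\in\{1,2,3\}$ and any Vénéreau-type polynomial $f=y+xQ$ (with $Q\in\mathbb{C}[x][v,w]$), $f-c$ is an $\tilde R_i$-hyperplane; that is, $\tilde R_i[y,z,u]/(f-c)\cong \tilde R_i^{[2]}$ as $\tilde R_i$-algebras.
   Context: For a commutative ring $A$ with one, $A^{[n]}$ denotes the polynomial ring in $n$ variables over $A$. Here $f-c$ is regarded as an element of $\tilde R_i[y,z,u]$ via the natural map $\mathbb{C}[x,c][y,z,u]\to\tilde R_i[y,z,u]$. *)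

(* Defs.v *)
(* R[i], for R : realType, is the field of complex numbers. *)
From HB Require Import structures.
From mathcomp Require Import all_boot all_algebra.
From mathcomp Require Import generic_quotient ring_quotient.
From mathcomp Require Import boolp reals.
From mathcomp Require Import complex.
From mathcomp Require Import mpoly.

Set Implicit Arguments.
Unset Strict Implicit.
Unset Printing Implicit Defensive.

Import GRing.Theory.
Local Open Scope ring_scope.
Local Open Scope quotient_scope.

(* The library only gives {ideal_quot I} a ring structure when I is a proper
   ideal; here A / (a) is a ring for every a, possibly the zero ring. *)
Section PrincipalQuotient.
Variables (A : comPzRingType) (a : A).

Definition principal : {pred A} := fun b => `[< exists q, b = q * a >].

Lemma principalP b : reflect (exists q, b = q * a) (b \in principal).
Proof. exact: asboolP. Qed.

Lemma principal_zmod_closed : zmod_closed principal.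
Proof.
split; first by apply/principalP; exists 0; rewrite mul0r.
move=> _ _ /principalP[q ->] /principalP[r ->].
by apply/principalP; exists (q - r); rewrite mulrBl.
Qed.

HB.instance Definition _ :=
  GRing.isZmodClosed.Build A principal principal_zmod_closed.

Definition pquot : Type := Quotient.quot principal.

HB.instance Definition _ := Choice.on pquot.
HB.instance Definition _ := GRing.Zmodule.on pquot.
HB.instance Definition _ := EqQuotient.on pquot.

Definition pquot_pi (b : A) : pquot := \pi_pquot b.

Lemma pquot_piP b c : reflect (pquot_pi b = pquot_pi c) (b - c \in principal).
Proof. by rewrite Quotient.idealrBE; apply: eqP. Qed.

Lemma pquot_piK (x : pquot) : pquot_pi (repr x) = x.
Proof. exact: reprK. Qed.

Lemma principalM b c : c \in principal -> b * c \in principal.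
Proof.
by move=> /principalP[q ->]; apply/principalP; exists (b * q); rewrite mulrA.
Qed.

Lemma pquot_pi_zmod_morphism : zmod_morphism pquot_pi.
Proof. by move=> b c; rewrite /pquot_pi !piE. Qed.

HB.instance Definition _ :=
  GRing.isZmodMorphism.Build A pquot pquot_pi pquot_pi_zmod_morphism.

Definition pquot_one : pquot := pquot_pi 1.
Definition pquot_mul (x y : pquot) : pquot := pquot_pi (repr x * repr y).

Lemma pquot_pi_mul b c : pquot_pi (b * c) = pquot_mul (pquot_pi b) (pquot_pi c).
Proof.
have h d : d - repr (pquot_pi d) \in principal.
  by apply/pquot_piP; rewrite pquot_piK.
apply/pquot_piP.
set b' := repr _; set c' := repr _.
have -> : b * c - b' * c' = c * (b - b') + b' * (c - c').
  by rewrite !mulrBr [c * b]mulrC [c * b']mulrC addrA subrK.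
by rewrite rpredD //; apply: principalM; apply: h.
Qed.

Lemma pquot_mulA : associative pquot_mul.
Proof.
move=> x y z; rewrite -[x]pquot_piK -[y]pquot_piK -[z]pquot_piK.
by rewrite -!pquot_pi_mul mulrA.
Qed.

Lemma pquot_mulC : commutative pquot_mul.
Proof.
by move=> x y; rewrite -[x]pquot_piK -[y]pquot_piK -!pquot_pi_mul mulrC.
Qed.

Lemma pquot_mul1 : left_id pquot_one pquot_mul.
Proof. by move=> x; rewrite -[x]pquot_piK -pquot_pi_mul mul1r. Qed.

Lemma pquot_mulDl : left_distributive pquot_mul +%R.
Proof.
move=> x y z; rewrite -[x]pquot_piK -[y]pquot_piK -[z]pquot_piK.
by rewrite -raddfD -!pquot_pi_mul mulrDl raddfD.
Qed.

HB.instance Definition _ := GRing.Zmodule_isComPzRing.Build pquot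
  pquot_mulA pquot_mulC pquot_mul1 pquot_mulDl.

Lemma pquot_pi_monoid_morphism : monoid_morphism pquot_pi.
Proof. by split=> // b c; apply: pquot_pi_mul. Qed.

HB.instance Definition _ :=
  GRing.isMonoidMorphism.Build A pquot pquot_pi pquot_pi_monoid_morphism.

End PrincipalQuotient.

(* If A is an S-algebra, so is A / (a): see pquot_scaleAl. *)
Section PrincipalQuotientAlgebra.
Variables (S : comPzRingType) (A : comAlgType S) (a : A).

Definition pquot_scale (s : S) (x : pquot a) : pquot a :=
  pquot_pi a (s *: repr x).

Lemma pquot_scale_mul s x : pquot_scale s x = pquot_pi a s%:A * x.
Proof. by rewrite -{2}[x]pquot_piK -rmorphM mulr_algl. Qed.

Lemma pquot_scaleA s t x :
  pquot_scale s (pquot_scale t x) = pquot_scale (s * t) x.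
Proof. by rewrite !pquot_scale_mul mulrA -rmorphM -scalerAl mul1r scalerA. Qed.

Lemma pquot_scale1 : left_id 1 pquot_scale.
Proof. by move=> x; rewrite pquot_scale_mul scale1r rmorph1 mul1r. Qed.

Lemma pquot_scaleDr : right_distributive pquot_scale +%R.
Proof. by move=> s x y; rewrite !pquot_scale_mul mulrDr. Qed.

Lemma pquot_scaleDl x : {morph pquot_scale^~ x : s t / s + t}.
Proof. by move=> s t; rewrite !pquot_scale_mul scalerDl rmorphD mulrDl. Qed.

HB.instance Definition _ := GRing.Zmodule_isLmodule.Build S (pquot a)
  pquot_scaleA pquot_scale1 pquot_scaleDr pquot_scaleDl.

Lemma pquot_scaleAl s (x y : pquot a) : s *: (x * y) = (s *: x) * y.
Proof. by rewrite /GRing.scale /= !pquot_scale_mul mulrA. Qed.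

End PrincipalQuotientAlgebra.

(* An isomorphism of S-algebras is a bijective S-linear map that preserves 1 and
   products; {lrmorphism _ -> _} is not available because the library's algebra
   structures exclude the zero ring. *)
Definition hyperplane (S : comNzRingType) (g : {mpoly S[3]}) : Prop :=
  exists phi : {linear pquot g -> {mpoly S[2]}},
    monoid_morphism phi /\ bijective phi.

Section Venereau.
Variable R : realType.
Local Notation C := R[i].

(* C[x][y,z,u] *)
Local Notation Cx := {poly C}.
Local Notation Cxyzu := {mpoly Cx[3]}.

Definition vx : Cxyzu := 'X%:MP.
Definition vy : Cxyzu := 'X_(@Ordinal 3 0 isT).
Definition vz : Cxyzu := 'X_(@Ordinal 3 1 isT).
Definition vu : Cxyzu := 'X_(@Ordinal 3 2 isT).

Definition pp : Cxyzu := vy * vu + vz ^+ 2.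
Definition vv : Cxyzu := vx * vz + vy * pp.
Definition ww : Cxyzu := vx ^+ 2 * vu - 2%:R * vx * vz * pp - vy * pp ^+ 2.

(* The elements of C[x][v,w] are the values at (v,w) of the polynomials in two
   variables over C[x]. *)
Definition venereau_type (f : Cxyzu) : Prop :=
  exists q : {mpoly Cx[2]}, f = vy + vx * (q \mPo [tuple vv; ww]).

(* C[x,c] *)
Local Notation Cxc := {mpoly C[2]}.

Definition bx : Cxc := 'X_(@Ordinal 2 0 isT).
Definition bc : Cxc := 'X_(@Ordinal 2 1 isT).

Definition Cx_to_Cxc : Cx -> Cxc := horner_alg bx.

Definition minus_c (f : Cxyzu) : {mpoly Cxc[3]} :=
  map_mpoly Cx_to_Cxc f - bc%:MP.

Inductive base_case : Type :=
  | X_const of C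
  | C_const of C
  | Cusp.

Definition base_poly (k : base_case) : Cxc :=
  match k with
  | X_const x0 => bx - x0%:MP
  | C_const c0 => bc - c0%:MP
  | Cusp => bx ^+ 2 - bc ^+ 3
  end.

Definition base_ring (k : base_case) : Type := pquot (base_poly k).

HB.instance Definition _ k := GRing.ComPzRing.on (base_ring k).

Lemma base_poly_zero k : exists t : 'I_2 -> C, (base_poly k).@[t] = 0.
Proof.
case: k => [x0|c0|] /=.
- by exists (fun=> x0); rewrite mevalB mevalXU mevalC subrr.
- by exists (fun=> c0); rewrite mevalB mevalXU mevalC subrr.
- by exists (fun=> 0); rewrite mevalB !rmorphXn /= !mevalXU !expr0n subrr.
Qed.

Lemma base_ring_oner_neq0 k : (1 : base_ring k) != 0.
Proof.
apply/eqP => h; have [t t0] := base_poly_zero k.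
have /pquot_piP/principalP[q] : pquot_pi (base_poly k) 1 = pquot_pi _ 0.
  by rewrite rmorph1 rmorph0.
rewrite subr0 => /(congr1 (meval t)).
by rewrite meval1 mevalM t0 mulr0 => /eqP; rewrite oner_eq0.
Qed.

HB.instance Definition _ k :=
  GRing.PzSemiRing_isNonZero.Build (base_ring k) (base_ring_oner_neq0 k).

Definition to_base_ring k : Cxc -> base_ring k := pquot_pi (base_poly k).

HB.instance Definition _ k := GRing.RMorphism.on (@to_base_ring k).
HB.instance Definition _ := GRing.LRMorphism.on Cx_to_Cxc.

End Venereau.

(* Main.v *)
(* Over a ring where x is invertible, yw + v^2 = x^2 p shows that (y, v, w) are
   coordinates, hence so are (f - c, v, w). If x = 0, then f = y. If c = 0, then v and w
   are divisible by x on f = 0, and the coordinates come from a polynomial flow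
   preserving p, with Q replaced by the constant Q(0,0). In the remaining cases write
   x = c t, so that y = c y', v = c v' and w = c w' on f = c, with y' = 1 - t Q.
   Since t^3 z = t^2 v' - y'^2 w' - y' v'^2, a Newton iteration in powers of t produces
   a polynomial g(v') such that w' + g(v') is divisible by t^3; v' and
   s = -(w' + g(v')) / t^3 are coordinates when c is a unit.

   On the cusp x = t^3, c = t^2 the same construction is first made over C[t], where v'
   itself becomes divisible by t^2 up to a polynomial in s. A linear change of
   determinant 1 then turns the coordinates into some (a, b) with z = a and u = b modulo
   t^2. As C[t^2, t^3] consists of the polynomials without term of degree 1, and f - c = y
   modulo t^2, the isomorphism restricts to C[t^2, t^3]. *)
Require Import Defs.
From HB Require Import structures.
From mathcomp Require Import all_boot all_algebra.
From mathcomp Require Import boolp reals complex mpoly ring.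

Set Implicit Arguments.
Unset Strict Implicit.
Unset Printing Implicit Defensive.

Import GRing.Theory.
Local Open Scope ring_scope.

(** * Substitution in multivariate polynomials *)

Lemma mpoly_ring_ind (S : comNzRingType) n (P : {mpoly S[n]} -> Prop) :
    (forall a, P a%:MP) -> (forall i, P 'X_i) ->
    (forall f g, P f -> P g -> P (f + g)) ->
    (forall f g, P f -> P g -> P (f * g)) ->
  forall f, P f.
Proof.
move=> PC PX PD PM; elim/mpolyind => [|a m f _ _ Pf]; first exact: PC.
apply: PD => //; rewrite -mul_mpolyC; apply: (PM) => //.
rewrite mpolyXE_id; elim/big_ind: _ => [|//|i _]; first exact: (PC 1).
elim: (m i) => [|k IHk]; first by rewrite expr0; exact: (PC 1).
by rewrite exprS; apply: PM.
Qed.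

Notation ev1 f a := (comp_mpoly [tuple a] f).
Notation ev2 f a b := (comp_mpoly [tuple a; b] f).
Notation ev3 f a b c := (comp_mpoly [tuple a; b; c] f).
Notation xa := ('X_(@Ordinal 2 0 isT)).
Notation xb := ('X_(@Ordinal 2 1 isT)).
Notation xy := ('X_(@Ordinal 3 0 isT)).
Notation xz := ('X_(@Ordinal 3 1 isT)).
Notation xu := ('X_(@Ordinal 3 2 isT)).

(** Both sides are ring morphisms in [f], so agreement on constants and variables suffices. With
    [psi] the identity this evaluates a substitution; with a quotient map it compares residues. *)
Lemma rmorph_comp_mpoly (S : comNzRingType) (E : comPzRingType) (n k l : nat)
    (phi : {rmorphism {mpoly S[k]} -> E}) (psi : {rmorphism {mpoly S[l]} -> E})
    (a : n.-tuple {mpoly S[k]}) (b : n.-tuple {mpoly S[l]}) :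
    (forall s, phi s%:MP = psi s%:MP) ->
    (forall i, phi (tnth a i) = psi (tnth b i)) ->
  forall f, phi (f \mPo a) = psi (f \mPo b).
Proof.
move=> eqC eqX; elim/mpoly_ring_ind => [s|i|f g Ef Eg|f g Ef Eg].
- by rewrite !comp_mpolyC.
- by rewrite !comp_mpolyXU -!tnth_nth.
- by rewrite !rmorphD /= Ef Eg.
- by rewrite !rmorphM /= Ef Eg.
Qed.

Lemma comp_mpolyA (S : comNzRingType) (n k l : nat) (f : {mpoly S[n]})
    (a : n.-tuple {mpoly S[k]}) (b : k.-tuple {mpoly S[l]}) :
  (f \mPo a) \mPo b = f \mPo [tuple tnth a i \mPo b | i < n].
Proof.
apply: (@rmorph_comp_mpoly _ _ _ _ _ (comp_mpoly b) idfun) => [s|i] /=.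
  exact: comp_mpolyC.
by rewrite tnth_mktuple.
Qed.

Lemma map_comp_mpoly (S A : comNzRingType) (h : {rmorphism S -> A}) n k
    (f : {mpoly S[n]}) (Y : n.-tuple {mpoly S[k]}) :
  map_mpoly h (f \mPo Y) = map_mpoly h f \mPo [tuple map_mpoly h (tnth Y i) | i < n].
Proof.
elim/mpoly_ring_ind: f => [s|i|f g Ef Eg|f g Ef Eg].
- by rewrite comp_mpolyC !map_mpolyC comp_mpolyC.
- by rewrite map_mpolyX !comp_mpolyXU -!tnth_nth tnth_mktuple.
- by rewrite (rmorphD (map_mpoly _)) !(rmorphD (comp_mpoly _)) (rmorphD (map_mpoly _)) /= Ef Eg.
- by rewrite (rmorphM (map_mpoly _)) !(rmorphM (comp_mpoly _)) (rmorphM (map_mpoly _)) /= Ef Eg.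
Qed.

Lemma comp_mpolyX_id (S : comNzRingType) n (f : {mpoly S[n]}) a :
  (forall i, tnth a i = 'X_i) -> f \mPo a = f.
Proof.
move=> aX; rewrite -[RHS]comp_mpoly_id.
by congr comp_mpoly; apply: eq_from_tnth => i; rewrite tnth_mktuple.
Qed.

(** * Presentations of a quotient of S[y, z, u] as a polynomial ring in two variables *)

Section Presentation.
Variables (S : comNzRingType).
Implicit Types (F : {mpoly S[3]}) (Y : 3.-tuple {mpoly S[2]}).

(** Substitution of [Y] is an S-algebra morphism from S[y, z, u] to a polynomial ring in two
    variables; the clauses say that it is onto with kernel ([F]). This elementwise form can be
    descended to a subring. *)
Definition presents F Y : Prop :=
  [/\ F \mPo Y = 0,
      forall g, g \mPo Y = 0 -> exists h, g = h * F
    & forall t, exists g, g \mPo Y = t].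

(** First isomorphism theorem: the map on representatives is well defined because [F] goes to 0, and
    chosen preimages give the inverse. *)
Lemma presents_hyperplane F Y : presents F Y -> hyperplane F.
Proof.
move=> [FY kerY surjY].
pose phi (x : pquot F) : {mpoly S[2]} := repr x \mPo Y.
have phiE g : phi (pquot_pi F g) = g \mPo Y.
  have /pquot_piP/principalP[q Eq] : pquot_pi F (repr (pquot_pi F g)) = pquot_pi F g.
    exact: pquot_piK.
  by apply/eqP; rewrite -subr_eq0 /phi -rmorphB /= Eq rmorphM /= FY mulr0.
have phiL : linear phi.
  move=> s x y; rewrite -[x]pquot_piK -[y]pquot_piK.
  rewrite {1}/GRing.scale /= pquot_scale_mul -rmorphM -rmorphD !phiE.
  by rewrite mulr_algl linearP.
have phiM : monoid_morphism phi.
  split; first by rewrite -(rmorph1 (pquot_pi F)) phiE rmorph1.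
  move=> x y; rewrite -[x]pquot_piK -[y]pquot_piK.
  by rewrite -rmorphM !phiE rmorphM.
pose mL := GRing.isLinear.Build _ _ _ _ phi phiL.
pose phiLin : {linear pquot F -> {mpoly S[2]}} := HB.pack phi mL.
exists phiLin; split=> //.
have [psi psiK] := choice surjY.
exists (pquot_pi F \o psi) => [x|t] /=; last by rewrite phiE.
rewrite -[x]pquot_piK phiE; apply/pquot_piP/principalP.
by apply: kerY; rewrite rmorphB /= psiK subrr.
Qed.

(** [Z] is the inverse substitution: if g(Y) = 0, then g(Y(Z)) = 0, and this is congruent to g
    modulo [F]. *)
Lemma presents_of_inverse F Y (Z : 2.-tuple {mpoly S[3]}) :
    F \mPo Y = 0 ->
    (forall i, tnth Z i \mPo Y = 'X_i) ->
    (forall i, pquot_pi F (tnth Y i \mPo Z) = pquot_pi F 'X_i) ->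
  presents F Y.
Proof.
move=> FY ZY YZ; split=> // [g gY|t].
  have /(congr1 (pquot_pi F)) := congr1 (comp_mpoly Z) gY.
  rewrite comp_mpolyA !rmorph0 => gYZ.
  apply/principalP; rewrite -[g]subr0; apply/pquot_piP.
  rewrite rmorph0 -gYZ -[in LHS](comp_mpoly_id g).
  apply: rmorph_comp_mpoly => // i.
  by rewrite !tnth_mktuple /= YZ.
exists (t \mPo Z); rewrite comp_mpolyA.
by apply: comp_mpolyX_id => i; rewrite tnth_mktuple ZY.
Qed.

Lemma presents_comp F Y (a b : 2.-tuple {mpoly S[2]}) :
    (forall i, tnth a i \mPo b = 'X_i) -> (forall i, tnth b i \mPo a = 'X_i) ->
  presents F Y -> presents F [tuple tnth Y i \mPo a | i < 3].
Proof.
move=> ab ba [FY kerY surjY].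
have abK g : (g \mPo a) \mPo b = g.
  by rewrite comp_mpolyA; apply: comp_mpolyX_id => i; rewrite tnth_mktuple ab.
have baK g : (g \mPo b) \mPo a = g.
  by rewrite comp_mpolyA; apply: comp_mpolyX_id => i; rewrite tnth_mktuple ba.
split=> [|g gY|t].
- by rewrite -comp_mpolyA FY rmorph0.
- by apply: kerY; rewrite -[LHS]abK (comp_mpolyA g) gY rmorph0.
- by have [g gY] := surjY (t \mPo b); exists g; rewrite -(comp_mpolyA g) gY baK.
Qed.

End Presentation.

(** * The expressions p, v and w over an arbitrary commutative ring *)

Section Coordinates.
Variable E : comPzRingType.
Implicit Types x y z u : E.

Definition pE y z u := y * u + z ^+ 2.
Definition vE x y z u := x * z + y * pE y z u.
Definition wE x y z u :=
  x ^+ 2 * u - 2%:R * x * z * pE y z u - y * pE y z u ^+ 2.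

End Coordinates.

(* rmorphXn comes before rmorphM, which would turn x ^+ 2 into x * x. *)
Definition rmE := (rmorphXn, rmorphD, rmorphB, rmorphN, rmorphM,
  rmorph1, rmorph0, rmorph_nat).

(** The constant [s] is f(0, 0); for Q it is the Q(0, 0) on which the case c = 0 and the cusp
    rest. *)
Lemma mpoly2_split (S : comNzRingType) (f : {mpoly S[2]}) :
  exists s g h, f = s%:MP + xa * g + xb * h.
Proof.
elim/mpoly_ring_ind: f => [s|i|f f' [s [g [h ->]]] [s' [g' [h' ->]]]|].
- by exists s, 0, 0; rewrite !mulr0 !addr0.
- exists 0; case: i => -[|[|//]] i; [exists 1, 0|exists 0, 1];
  rewrite mpolyC0 mulr1 mulr0 ?addr0 !add0r; congr 'X_ _; exact: val_inj.
- by exists (s + s'), (g + g'), (h + h'); rewrite mpolyCD; ring.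
- move=> f f' [s [g [h ->]]] [s' [g' [h' ->]]].
  exists (s * s'), (s%:MP * g' + g * (s'%:MP + xa * g' + xb * h')),
    (s%:MP * h' + h * (s'%:MP + xa * g' + xb * h')).
  by rewrite mpolyCM; ring.
Qed.

(** * Vénéreau-type polynomials when x is zero or a unit, or c is zero *)

Section VenereauType.
Variables (S : comNzRingType) (x c : S) (Q : {mpoly S[2]}).

(** This is f - c with [x] and [c] arbitrary elements of the base ring, so that it is stable under
    base change. *)
Definition venF : {mpoly S[3]} :=
  xy + x%:MP * ev2 Q (vE x%:MP xy xz xu) (wE x%:MP xy xz xu) - c%:MP.

Lemma rmorph_pE (E E' : comPzRingType) (phi : {rmorphism E -> E'}) y z u :
  phi (pE y z u) = pE (phi y) (phi z) (phi u).
Proof. by rewrite /pE !rmE. Qed.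

Lemma rmorph_vE (E E' : comPzRingType) (phi : {rmorphism E -> E'}) r y z u :
  phi (vE r y z u) = vE (phi r) (phi y) (phi z) (phi u).
Proof. by rewrite /vE /pE !rmE. Qed.

Lemma rmorph_wE (E E' : comPzRingType) (phi : {rmorphism E -> E'}) r y z u :
  phi (wE r y z u) = wE (phi r) (phi y) (phi z) (phi u).
Proof. by rewrite /wE /pE !rmE. Qed.

Lemma rmorph_ev1 (E : comPzRingType) (k l : nat)
    (phi : {rmorphism {mpoly S[k]} -> E}) (psi : {rmorphism {mpoly S[l]} -> E}) a a' :
    (forall s, phi s%:MP = psi s%:MP) -> phi a = psi a' ->
  forall f, phi (ev1 f a) = psi (ev1 f a').
Proof.
move=> eqC ea; apply: rmorph_comp_mpoly => //.
by case=> -[|//] /= i; rewrite !(tnth_nth 0).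
Qed.

Lemma rmorph_ev2 (E : comPzRingType) (k l : nat)
    (phi : {rmorphism {mpoly S[k]} -> E}) (psi : {rmorphism {mpoly S[l]} -> E}) a b a' b' :
    (forall s, phi s%:MP = psi s%:MP) -> phi a = psi a' -> phi b = psi b' ->
  forall f, phi (ev2 f a b) = psi (ev2 f a' b').
Proof.
move=> eqC ea eb; apply: rmorph_comp_mpoly => //.
by case=> -[|[|//]] /= i; rewrite !(tnth_nth 0).
Qed.

Lemma ev2X (f : {mpoly S[2]}) : ev2 f xa xb = f.
Proof.
apply: comp_mpolyX_id => -[[|[|//]] /= i]; rewrite (tnth_nth 0) /=;
by congr 'X_ _; apply: val_inj.
Qed.

(** The inverse criterion, with its conditions asked for all morphisms instead of the substitution
    and the quotient map at which they are used. The images of y, z, u are then opaque ring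
    elements, and the conditions become plain ring identities. *)
Lemma presents_venF (Y Z U : {mpoly S[2]}) (a b : {mpoly S[3]}) :
    Y + x%:MP * ev2 Q (vE x%:MP Y Z U) (wE x%:MP Y Z U) = c%:MP ->
    (forall phi : {rmorphism {mpoly S[3]} -> {mpoly S[2]}},
       (forall s, phi s%:MP = s%:MP) -> phi xy = Y -> phi xz = Z -> phi xu = U ->
       phi a = xa /\ phi b = xb) ->
    (forall (E : comPzRingType) (phi : {rmorphism {mpoly S[3]} -> E})
            (psi : {rmorphism {mpoly S[2]} -> E}),
       (forall s, psi s%:MP = phi s%:MP) -> psi xa = phi a -> psi xb = phi b ->
       phi xy = phi c%:MP - phi x%:MP *
         phi (ev2 Q (vE x%:MP xy xz xu) (wE x%:MP xy xz xu)) ->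
       [/\ psi Y = phi xy, psi Z = phi xz & psi U = phi xu]) ->
  presents venF [tuple Y; Z; U].
Proof.
move=> FY fwd bwd; pose Z' := [tuple a; b].
have [] := fwd (comp_mpoly [tuple Y; Z; U]).
- by move=> s; rewrite /= comp_mpolyC.
- by rewrite /= comp_mpolyXU.
- by rewrite /= comp_mpolyXU.
- by rewrite /= comp_mpolyXU.
move=> /= aY bY; apply: (@presents_of_inverse _ _ _ Z').
- rewrite /venF !rmE /= !comp_mpolyC comp_mpolyXU /=.
  rewrite (@rmorph_ev2 _ _ _ (comp_mpoly _) idfun _ _ (vE x%:MP Y Z U) (wE x%:MP Y Z U)).
  + by rewrite /= FY subrr.
  + by move=> s; rewrite /= comp_mpolyC.
  + by rewrite rmorph_vE /= comp_mpolyC !comp_mpolyXU.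
  + by rewrite rmorph_wE /= comp_mpolyC !comp_mpolyXU.
- by case=> -[|[|//]] i; rewrite (tnth_nth 0) /= ?aY ?bY; congr 'X_ _; apply: val_inj.
have [] := bwd _ (pquot_pi venF) (pquot_pi venF \o comp_mpoly Z').
- by move=> s; rewrite /= comp_mpolyC.
- by rewrite /= comp_mpolyXU.
- by rewrite /= comp_mpolyXU.
(* The difference of the two sides is [venF] itself, hence the cofactor 1. *)
- rewrite -!rmorphM -!rmorphB; apply/pquot_piP/principalP; exists 1.
  by rewrite mul1r /venF; ring.
move=> /= eY eZ eU; case=> -[|[|[|//]]] i; rewrite (tnth_nth 0) /= ?eY ?eZ ?eU;
  by congr (pquot_pi _ 'X_ _); apply: val_inj.
Qed.

Lemma presents_x0 : x = 0 -> presents venF [tuple c%:MP; xa; xb].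
Proof.
move=> x0; apply: (@presents_venF _ _ _ xz xu).
- by rewrite x0 mul0r addr0.
- by [].
- by move=> E phi psi eqC -> -> ->; rewrite eqC x0 rmorph0 rmorph0 mul0r subr0.
Qed.

Lemma presents_x_unit d : d * x = 1 -> exists Y, presents venF Y.
Proof.
move=> dx; have dxE n : d%:MP_[n] * x%:MP = 1 by rewrite -mpolyCM dx.
(* Opaque names, because the lemmas on morphisms unfold local definitions. *)
have [Y EY] : exists Y : {mpoly S[2]}, Y = c%:MP - x%:MP * Q by eexists.
(* With v = [xa] and w = [xb], these formulas solve y w + v^2 = x^2 p for p, then the definition of
   v for z and that of w for u. *)
have [P EP] : exists P, P = d%:MP ^+ 2 * (Y * xb + xa ^+ 2) by eexists.
have [Z EZ] : exists Z, Z = d%:MP * (xa - Y * P) by eexists.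
have [U EU] : exists U, U = d%:MP ^+ 2 * (xb + 2%:R * x%:MP * Z * P + Y * P ^+ 2).
  by eexists.
have PE : pE Y Z U = P.
  by rewrite /pE EU EZ {2 4}EP EP; ring: (dxE 2).
have VE : vE x%:MP Y Z U = xa by rewrite /vE PE EZ; ring: (dxE 2).
have WE : wE x%:MP Y Z U = xb by rewrite /wE PE EU; ring: (dxE 2).
exists [tuple Y; Z; U].
apply: (@presents_venF _ _ _ (vE x%:MP xy xz xu) (wE x%:MP xy xz xu)).
- by rewrite VE WE ev2X EY subrK.
- by move=> phi phiC eY eZ eU; rewrite rmorph_vE rmorph_wE phiC eY eZ eU.
move=> E phi psi eqC ea eb ey.
have dxphi : phi d%:MP * phi x%:MP = 1 by rewrite -rmorphM dxE rmorph1.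
have eY : psi Y = phi xy.
  rewrite EY !rmE !eqC ey -{1}(ev2X Q).
  by congr (_ - _ * _); apply: rmorph_ev2.
have eP : psi P = pE (phi xy) (phi xz) (phi xu).
  by rewrite EP !rmE eY eqC ea eb rmorph_vE rmorph_wE /vE /wE /pE; ring: dxphi.
have eZ : psi Z = phi xz.
  by rewrite EZ !rmE eP eY eqC ea rmorph_vE /vE; ring: dxphi.
split=> //; rewrite EU !rmE eZ eP eY !eqC eb rmorph_wE /wE; ring: dxphi.
Qed.

(* v1 = v / x and w1 = w / x are polynomials in z, u, and (z, u) is obtained from
   (v1, w1) by a flow along which p is constant, up to replacing Q by Q(0,0) and
   dividing by x. *)
Lemma presents_c0 : c = 0 -> exists Y, presents venF Y.
Proof.
move=> c0; have [q [Qa [Qb EQ]]] := mpoly2_split Q.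
have EQv n (V W : {mpoly S[n]}) :
    ev2 Q V W = q%:MP + V * ev2 Qa V W + W * ev2 Qb V W.
  by rewrite EQ !rmE /= comp_mpolyC !comp_mpolyXU.
(* With Q replaced by the constant [q], these are the values of p, v / x and w / x at y = - x q, z =
   [xa], u = [xb]. They satisfy p0 = v1^2 - q w1. *)
have [p0 Ep0] : exists p0, p0 = xa ^+ 2 - q%:MP * x%:MP * xb by eexists.
have [v1 Ev1] : exists v1, v1 = xa - q%:MP * p0 by eexists.
have [w1 Ew1] : exists w1, w1 = x%:MP * xb - 2%:R * xa * p0 + q%:MP * p0 ^+ 2.
  by eexists.
have [V EV] : exists V, V = x%:MP * v1 by eexists.
have [W EW] : exists W, W = x%:MP * w1 by eexists.
have [R ER] : exists R, R = v1 * ev2 Qa V W + w1 * ev2 Qb V W by eexists.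
have EQR : ev2 Q V W = q%:MP + x%:MP * R.
  by rewrite EQv ER; move: (ev2 Qa _ _) (ev2 Qb _ _) => A B; rewrite EV EW; ring.
(* For given v / x and w / x one has p = v1^2 - Q w1, so passing from q to Q = q + x R subtracts x R
   w1 from p. *)
have [P EP] : exists P, P = p0 - x%:MP * R * w1 by eexists.
have [Y EY] : exists Y, Y = - (x%:MP * ev2 Q V W) by eexists.
have [Z EZ] : exists Z, Z = v1 + ev2 Q V W * P by eexists.
(* This is (w1 + 2 v1 P + Q P^2) / x. The division is exact by comparison with x [xb] = w1 + 2 v1 p0
   + q p0^2, as P = p0 and Q = q modulo x. *)
have [U EU] : exists U, U = xb - 2%:R * R * v1 * w1 + R * P ^+ 2
                            - q%:MP * R * w1 * (P + p0) by eexists.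
have PE : pE Y Z U = P.
  by rewrite /pE EU EZ EY EQR EP Ev1 Ew1 Ep0; ring.
have VE : vE x%:MP Y Z U = V by rewrite /vE PE EZ EY EV; ring.
have WE : wE x%:MP Y Z U = W.
  by rewrite /wE PE EU EZ EY EQR EW EP Ew1 Ev1 Ep0; ring.
exists [tuple Y; Z; U].
have [v Ev] : exists v, v = vE x%:MP xy xz xu by eexists.
have [w Ew] : exists w, w = wE x%:MP xy xz xu by eexists.
have [p Ep] : exists p : {mpoly S[3]}, p = pE xy xz xu by eexists.
have [v1' Ev1'] : exists v1', v1' = xz - ev2 Q v w * p by eexists.
have [w1' Ew1'] : exists w1', w1' = x%:MP * xu - 2%:R * xz * p + ev2 Q v w * p ^+ 2.
  by eexists.
have [R' ER'] : exists R', R' = v1' * ev2 Qa v w + w1' * ev2 Qb v w by eexists.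
(* The formulas for [Z] and [U] are solved for [xa] and [xb], with p0 = p + x R' w1'. *)
have [a Ea] : exists a, a = v1' + q%:MP * (p + x%:MP * R' * w1') by eexists.
have [b Eb] : exists b, b = xu + 2%:R * R' * v1' * w1' - R' * p ^+ 2
    + q%:MP * R' * w1' * (2%:R * p + x%:MP * R' * w1') by eexists.
apply: (@presents_venF _ _ _ a b).
- by rewrite VE WE EY c0 mpolyC0 addNr.
- move=> phi phiC eY eZ eU.
  have ev : phi v = V by rewrite Ev rmorph_vE phiC eY eZ eU.
  have ew : phi w = W by rewrite Ew rmorph_wE phiC eY eZ eU.
  have ef f : phi (ev2 f v w) = ev2 f V W.
    exact: (@rmorph_ev2 _ _ _ phi idfun).
  have ep : phi p = P by rewrite Ep rmorph_pE eY eZ eU.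
  have ev1 : phi v1' = v1 by rewrite Ev1' !rmE ef eZ ep EZ addrK.
  have ew1 : phi w1' = w1.
    rewrite Ew1' !rmE ef eZ ep eU phiC EZ EU EQR EP Ew1 Ev1 Ep0; ring.
  have eR : phi R' = R by rewrite ER' !rmE ev1 ew1 !ef ER.
  split; first by rewrite Ea !rmE ev1 ep eR ew1 !phiC EP Ev1; ring.
  by rewrite Eb !rmE ev1 ep eR ew1 !phiC eU EU EP; ring.
move=> E phi psi eqC ea eb; rewrite -Ev -Ew c0 mpolyC0 rmorph0 sub0r => ey.
have ev : phi v = phi x%:MP * phi v1'.
  by rewrite Ev rmorph_vE Ev1' !rmE ey /vE Ep rmorph_pE ey; ring.
have ew : phi w = phi x%:MP * phi w1'.
  by rewrite Ew rmorph_wE Ew1' !rmE ey /wE Ep rmorph_pE ey; ring.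
have eQR : phi (ev2 Q v w) = phi q%:MP + phi x%:MP * phi R'.
  rewrite EQv ER'; move: (ev2 Qa v w) (ev2 Qb v w) => A1 A2.
  by rewrite !rmE ev ew; ring.
have ev1 : phi v1' = phi xz - phi (ev2 Q v w) * phi p by rewrite Ev1' !rmE.
have ew1 : phi w1' = phi x%:MP * phi xu - 2%:R * phi xz * phi p
    + phi (ev2 Q v w) * phi p ^+ 2 by rewrite Ew1' !rmE.
have ep : phi p = - (phi x%:MP * phi (ev2 Q v w)) * phi xu + phi xz ^+ 2.
  by rewrite Ep rmorph_pE ey.
have ep' : phi p + phi x%:MP * phi R' * phi w1' = phi v1' ^+ 2 - phi q%:MP * phi w1'.
  by rewrite ev1 ew1 ep eQR; ring.
have eXb : phi x%:MP * phi b = phi w1' + 2%:R * phi v1' * (phi v1' ^+ 2 - phi q%:MP * phi w1')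
    + phi q%:MP * (phi v1' ^+ 2 - phi q%:MP * phi w1') ^+ 2.
  have -> : phi b = phi xu + 2%:R * phi R' * phi v1' * phi w1' - phi R' * phi p ^+ 2
    + phi q%:MP * phi R' * phi w1' * (2%:R * phi p + phi x%:MP * phi R' * phi w1').
    by rewrite Eb !rmE.
  rewrite -ep' ev1 ew1 eQR; ring.
have ep0 : psi p0 = phi v1' ^+ 2 - phi q%:MP * phi w1'.
  rewrite Ep0 !rmE !eqC ea eb -mulrA eXb Ea !rmE ep'; ring.
have ev1x : psi v1 = phi v1' by rewrite Ev1 !rmE eqC ep0 ea Ea !rmE ep' addrK.
have ew1x : psi w1 = phi w1'.
  by rewrite Ew1 !rmE !eqC ea eb ep0 eXb Ea !rmE ep'; ring.
have ef f : psi (ev2 f V W) = phi (ev2 f v w).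
  by apply: rmorph_ev2 => //; rewrite ?EV ?EW !rmE eqC ?ev1x ?ew1x.
have eR : psi R = phi R' by rewrite ER ER' !rmE !ef ev1x ew1x.
have eP : psi P = phi p.
  rewrite EP !rmE !eqC ep0 eR ew1x -ep'; ring.
have eY : psi Y = phi xy by rewrite EY !rmE eqC ef ey.
have eZ : psi Z = phi xz by rewrite EZ !rmE ef ev1x eP ev1 subrK.
split=> //; rewrite EU !rmE !eqC ep0 -ep' eR ew1x ev1x eP eb Eb !rmE; ring.
Qed.

End VenereauType.

(** * Newton approximation and divided differences *)

Notation xv := ('X_(@Ordinal 1 0 isT)).

Section NewtonApproximation.
Variable S : comNzRingType.

Lemma comp_ev1 n k (T : n.-tuple {mpoly S[k]}) f a :
  (ev1 f a) \mPo T = ev1 f (a \mPo T).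
Proof. by apply: (@rmorph_ev1 _ _ _ _ (comp_mpoly T) idfun) => // s; exact: comp_mpolyC. Qed.

Lemma comp_ev2 n k (T : n.-tuple {mpoly S[k]}) f a b :
  (ev2 f a b) \mPo T = ev2 f (a \mPo T) (b \mPo T).
Proof. by apply: (@rmorph_ev2 _ _ _ _ (comp_mpoly T) idfun) => // s; exact: comp_mpolyC. Qed.

Lemma ev2_shift n (f : {mpoly S[2]}) (v w d : {mpoly S[n]}) :
  exists h, ev2 f v (w + d) = ev2 f v w + d * h.
Proof.
elim/mpoly_ring_ind: f => [s|i|f f' [h eh] [h' eh']|f f' [h eh] [h' eh']].
- by exists 0; rewrite !comp_mpolyC mulr0 addr0.
- rewrite !comp_mpolyXU; case: i => -[|[|//]] i /=; first by exists 0; ring.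
  by exists 1; ring.
- by exists (h + h'); rewrite !rmorphD /= eh eh'; ring.
- exists (ev2 f v w * h' + h * ev2 f' v w + d * h * h').
  by rewrite !rmorphM /= eh eh'; ring.
Qed.

(* Newton iteration: replacing g by g - t^k r gains a factor t, as y = 1 modulo t. *)
Lemma newton_approx (t : S) (f : {mpoly S[2]}) k :
  exists g r : {mpoly S[1]},
    t%:MP ^+ 2 * xv - (1 - t%:MP * ev2 f xv (- g)) * xv ^+ 2
      + (1 - t%:MP * ev2 f xv (- g)) ^+ 2 * g = t%:MP ^+ k * r.
Proof.
elim: k => [|k [g [r Er]]]; first by exists 0; eexists; rewrite expr0 mul1r.
have [h Eh] := ev2_shift f xv (- g) (t%:MP ^+ k * r).
exists (g - t%:MP ^+ k * r); rewrite opprB addrC [_ - g]addrC.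
move: Er Eh; set e := ev2 f xv (- g); set e' := ev2 f xv (- g + _) => Er Eh.
(* The cofactor collects 1 - (1 - t e')^2 = t e' (2 - t e') and the change e' - e = t^k r h of f. *)
exists (r * (2%:R - t%:MP * e') * e'
   + r * h * (xv ^+ 2 + (t%:MP ^+ k.+1 * r * h - 2%:R * (1 - t%:MP * e)) * g)).
have Eg : t%:MP ^+ 2 * xv = t%:MP ^+ k * r + (1 - t%:MP * e) * xv ^+ 2 - (1 - t%:MP * e) ^+ 2 * g.
  by rewrite -Er; ring.
have Ee : e = e' - t%:MP ^+ k * r * h by rewrite Eh addrK.
by rewrite !(exprS _ k) Eg Ee; ring.
Qed.

Lemma newton_approx_ev (t : S) (f : {mpoly S[2]}) k :
  exists g r : {mpoly S[1]}, forall n (v : {mpoly S[n]}),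
    t%:MP ^+ 2 * v - (1 - t%:MP * ev2 f v (- ev1 g v)) * v ^+ 2
      + (1 - t%:MP * ev2 f v (- ev1 g v)) ^+ 2 * ev1 g v = t%:MP ^+ k * ev1 r v.
Proof.
have [g [r Er]] := newton_approx t f k; exists g, r => n v.
have := congr1 (comp_mpoly [tuple v]) Er.
by rewrite !rmE /= !comp_ev2 rmorphN /= !comp_mpolyC !comp_mpolyXU /=.
Qed.

(** Shifting at the generic point ([xa], [xb]) and substituting afterwards gives one [h] for all [v]
    and [w]. *)
Lemma divided_difference (f : {mpoly S[2]}) (g : {mpoly S[1]}) :
  exists h, forall n (v w : {mpoly S[n]}),
    ev2 f v w = ev2 f v (- ev1 g v) + (w + ev1 g v) * ev2 h v w.
Proof.
have [h Eh] := ev2_shift f xa (- ev1 g xa) (xb + ev1 g xa).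
exists h => n v w; have := congr1 (comp_mpoly [tuple v; w]) Eh.
by rewrite !rmE /= !comp_ev2 !rmE /= !comp_ev1 !comp_mpolyXU /= addrC addrK.
Qed.

End NewtonApproximation.

(** * Solving for p, u and s when x = c t *)

(* For y = 1 - t q the elements p, u and s = sOf are determined by their products with a
   power of t and with y or slope, both 1 modulo t; pOf, uOf, sOf and, further down,
   u2Of are the corresponding Bezout combinations. The relation behind slope is
   z = r + slope * s, where t ^ 3 s = - (w + g). *)
Section Reconstruction.
Variables (E : comPzRingType) (t v w q : E).

Definition pOf z := (1 + t * q) * (v - t * z) + q ^+ 2 * ((1 - t * q) * w + v ^+ 2).
Definition uOf z p := (1 + t * q) * (p - z ^+ 2)
  + q ^+ 2 * (w + 2%:R * t * z * p + (1 - t * q) * p ^+ 2).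
Definition slope g q0 h := (1 - t * q) ^+ 2 
  + t * h * ((2%:R - t * q - t * q0) * g - v ^+ 2).
Definition slope1 g q0 h := t * q ^+ 2 - 2%:R * q + h * ((2%:R - t * q - t * q0) * g - v ^+ 2).
Definition sOf g q0 h z := (1 - t * slope1 g q0 h + t ^+ 2 * slope1 g q0 h ^+ 2) * z
  + slope1 g q0 h ^+ 3 * (w + g).

Lemma slopeE g q0 h : slope g q0 h = 1 + t * slope1 g q0 h.
Proof. rewrite /slope /slope1; ring. Qed.

(** The expression will be t^3 z. Passing from ([q0], [- g]) to ([q], [w]) changes it by a multiple
    of [w + g], and the quotient is [- slope]. *)
Lemma slopeP g q0 h n : q = q0 + (w + g) * h ->
    t ^+ 2 * v - (1 - t * q0) * v ^+ 2 + (1 - t * q0) ^+ 2 * g = n ->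
  t ^+ 2 * v - (1 - t * q) * v ^+ 2 - (1 - t * q) ^+ 2 * w = n - (w + g) * slope g q0 h.
Proof. move=> Eq <-; rewrite /slope Eq; ring. Qed.

(** The Bezout identity is (1 + t q)(1 - t q) + q^2 t^2 = 1. The hypothesis makes the two prescribed
    products compatible: multiplied crosswise they agree. *)
Lemma pOfP z : t ^+ 3 * z = t ^+ 2 * v - (1 - t * q) * v ^+ 2 - (1 - t * q) ^+ 2 * w ->
  (1 - t * q) * pOf z = v - t * z /\ t ^+ 2 * pOf z = (1 - t * q) * w + v ^+ 2.
Proof.
move=> Ez; have Ew : (1 - t * q) * ((1 - t * q) * w + v ^+ 2) = t ^+ 2 * (v - t * z).
  by rewrite mulrBr mulrA -exprSr Ez; ring.
split.
- transitivity ((1 - t ^+ 2 * q ^+ 2) * (v - t * z) 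
     + q ^+ 2 * ((1 - t * q) * ((1 - t * q) * w + v ^+ 2))); first by rewrite /pOf; ring.
  by rewrite Ew; ring.
- transitivity ((1 + t * q) * (t ^+ 2 * (v - t * z)) 
     + t ^+ 2 * q ^+ 2 * ((1 - t * q) * w + v ^+ 2)); first by rewrite /pOf; ring.
  by rewrite -Ew; ring.
Qed.

Lemma pOfK z p : (1 - t * q) * p = v - t * z -> t ^+ 2 * p = (1 - t * q) * w + v ^+ 2 ->
  pOf z = p.
Proof. by rewrite /pOf => <- <-; ring. Qed.

Lemma uOfP z p : (1 - t * q) * p = v - t * z -> t ^+ 2 * p = (1 - t * q) * w + v ^+ 2 ->
  (1 - t * q) * uOf z p = p - z ^+ 2 
  /\ t ^+ 2 * uOf z p = w + 2%:R * t * z * p + (1 - t * q) * p ^+ 2.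
Proof.
move=> E1 E2; set m := w + 2%:R * t * z * p + (1 - t * q) * p ^+ 2.
have Em : (1 - t * q) * m = t ^+ 2 * (p - z ^+ 2).
  transitivity ((1 - t * q) * w + 2%:R * t * z * ((1 - t * q) * p) + ((1 - t * q) * p) ^+ 2).
    by rewrite /m; ring.
  by rewrite E1 [t ^+ 2 * (p - _)]mulrBr E2; ring.
split.
- transitivity ((1 - t ^+ 2 * q ^+ 2) * (p - z ^+ 2) + q ^+ 2 * ((1 - t * q) * m)).
    by rewrite /uOf -/m; ring.
  by rewrite Em; ring.
- transitivity ((1 + t * q) * (t ^+ 2 * (p - z ^+ 2)) + t ^+ 2 * q ^+ 2 * m).
    by rewrite /uOf -/m; ring.
  by rewrite -Em; ring.
Qed.

Lemma uOfK z p u : (1 - t * q) * u = p - z ^+ 2 ->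
    t ^+ 2 * u = w + 2%:R * t * z * p + (1 - t * q) * p ^+ 2 ->
  uOf z p = u.
Proof. by rewrite /uOf => <- <-; ring. Qed.

(** With l = [slope1] the Bezout identity is (1 - t l + t^2 l^2)(1 + t l) - l^3 t^3 = 1. *)
Lemma sOfP g q0 h z : t ^+ 3 * z = - (w + g) * slope g q0 h ->
  slope g q0 h * sOf g q0 h z = z /\ t ^+ 3 * sOf g q0 h z = - (w + g).
Proof.
rewrite slopeE /sOf; set l := slope1 _ _ _ => Ez; split.
- transitivity (z + l ^+ 3 * (t ^+ 3 * z + (w + g) * (1 + t * l))); first by ring.
  by rewrite Ez; ring.
- transitivity ((1 - t * l + t ^+ 2 * l ^+ 2) * (t ^+ 3 * z) + t ^+ 3 * l ^+ 3 * (w + g)).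
    by ring.
  by rewrite Ez; ring.
Qed.

Lemma sOfK g q0 h s z : z = slope g q0 h * s -> w = - g - t ^+ 3 * s ->
  sOf g q0 h z = s.
Proof. by rewrite slopeE /sOf => -> ->; ring. Qed.

End Reconstruction.

Section Morphisms.
Variables (E E' : comPzRingType) (phi : {rmorphism E -> E'}) (t v w q g q0 h z p : E).

Lemma rmorph_pOf : phi (pOf t v w q z) = pOf (phi t) (phi v) (phi w) (phi q) (phi z).
Proof. by rewrite /pOf !rmE. Qed.

Lemma rmorph_uOf : phi (uOf t w q z p) = uOf (phi t) (phi w) (phi q) (phi z) (phi p).
Proof. by rewrite /uOf !rmE. Qed.

Lemma rmorph_slope : phi (slope t v q g q0 h)
  = slope (phi t) (phi v) (phi q) (phi g) (phi q0) (phi h).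
Proof. by rewrite /slope !rmE. Qed.

Lemma rmorph_sOf : phi (sOf t v w q g q0 h z)
  = sOf (phi t) (phi v) (phi w) (phi q) (phi g) (phi q0) (phi h) (phi z).
Proof. by rewrite /sOf /slope1 !rmE. Qed.

End Morphisms.

(* The case y = c y', u' = c u of x = c t: v = c v' and w = c w'. *)
Lemma vE_scale (E : comPzRingType) (c t y z u : E) :
  vE (c * t) (c * y) z u = c * (t * z + y * (y * (c * u) + z ^+ 2)).
Proof. rewrite /vE /pE; ring. Qed.

Lemma wE_scale (E : comPzRingType) (c t y z u : E) :
  wE (c * t) (c * y) z u = c * (t ^+ 2 * (c * u)
    - 2%:R * t * z * (y * (c * u) + z ^+ 2) - y * (y * (c * u) + z ^+ 2) ^+ 2).
Proof. rewrite /wE /pE; ring. Qed.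

(** * The case of a unit c *)

Section UnitC.
Variables (S : comNzRingType) (x c : S) (Q : {mpoly S[2]}).

(** [xa] and [xb] stand for v' and s. They determine in turn w' = - g(v') - t^3 s, then Q, z = r +
    slope s, p and c u; the last is divided by the unit c. *)
Lemma presents_c_unit d : d * c = 1 -> exists Y, presents (venF x c Q) Y.
Proof.
move=> dc; have [t Et] : exists t, t = d * x by eexists.
have dcE n : d%:MP_[n] * c%:MP = 1 by rewrite -mpolyCM dc.
have xE n : x%:MP_[n] = c%:MP * t%:MP.
  by rewrite Et mpolyCM mulrA [c%:MP * _]mulrC dcE mul1r.
have [f EfQ] : exists f : {mpoly S[2]}, forall n (v w : {mpoly S[n]}),
    ev2 f v w = ev2 Q (c%:MP * v) (c%:MP * w).
  exists (ev2 Q (c%:MP * xa) (c%:MP * xb)) => n v w.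
  by rewrite comp_ev2 !rmorphM /= !comp_mpolyC !comp_mpolyXU.
(* Order 3 is what allows t^3 z = t^3 r - (w' + g) slope to be divided by t^3. *)
have [g [r Er]] := newton_approx_ev t f 3; have [h Eh] := divided_difference f g.
have [w Ew] : exists w, w = - ev1 g xa - t%:MP ^+ 3 * xb by eexists.
have [q Eq] : exists q, q = ev2 f xa w by eexists.
have [q0 Eq0] : exists q0, q0 = ev2 f xa (- ev1 g xa) by eexists.
have Eqh : q = q0 + (w + ev1 g xa) * ev2 h xa w by rewrite Eq Eq0 Eh.
have [Y EY] : exists Y, Y = c%:MP * (1 - t%:MP * q) by eexists.
have [l El] : exists l, l = slope t%:MP xa q (ev1 g xa) q0 (ev2 h xa w) by eexists.
have [Z EZ] : exists Z, Z = ev1 r xa + l * xb by eexists.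
have [P EP] : exists P, P = pOf t%:MP xa w q Z by eexists.
have [U EU] : exists U, U = d%:MP * uOf t%:MP w q Z P by eexists.
(* As t may be a zero divisor, Z is defined first and its relation to v', w' is checked
   afterwards. *)
have Ez : t%:MP ^+ 3 * Z = t%:MP ^+ 2 * xa - (1 - t%:MP * q) * xa ^+ 2
    - (1 - t%:MP * q) ^+ 2 * w.
  have Er' := Er _ xa; rewrite -Eq0 in Er'.
  by rewrite (slopeP Eqh Er') -El EZ Ew; ring.
have [P1 P2] := pOfP Ez; rewrite -EP in P1 P2.
have [U1 U2] := uOfP P1 P2.
have cU : c%:MP * U = uOf t%:MP w q Z P by rewrite EU mulrCA mulrA dcE mul1r.
rewrite -cU in U1 U2.
have PE : (1 - t%:MP * q) * (c%:MP * U) + Z ^+ 2 = P by rewrite U1 subrK.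
have VE : vE x%:MP Y Z U = c%:MP * xa.
  by rewrite EY xE vE_scale PE P1 addrC subrK.
have WE : wE x%:MP Y Z U = c%:MP * w.
  by rewrite EY xE wE_scale PE U2; ring.
exists [tuple Y; Z; U].
have [q' Eq'] : exists q', q' = ev2 Q (vE x%:MP xy xz xu) (wE x%:MP xy xz xu).
  by eexists.
have [p' Ep'] : exists p', p' = (1 - t%:MP * q') * (c%:MP * xu) + xz ^+ 2 by eexists.
have [v' Ev'] : exists v', v' = t%:MP * xz + (1 - t%:MP * q') * p' by eexists.
have [w' Ew'] : exists w', w' = t%:MP ^+ 2 * (c%:MP * xu)
    - 2%:R * t%:MP * xz * p' - (1 - t%:MP * q') * p' ^+ 2 by eexists.
have [s' Es'] : exists s', s' = sOf t%:MP v' w' q' (ev1 g v')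
   (ev2 f v' (- ev1 g v')) (ev2 h v' w') (xz - ev1 r v') by eexists.
apply: (@presents_venF _ _ _ _ _ _ _ v' s').
- by rewrite VE WE -EfQ -Eq EY xE; ring.
- move=> phi phiC eY eZ eU.
  have ef f' a b : phi (ev2 f' a b) = ev2 f' (phi a) (phi b).
    by apply: (@rmorph_ev2 _ _ _ _ phi idfun).
  have ef1 f' a : phi (ev1 f' a) = ev1 f' (phi a).
    by apply: (@rmorph_ev1 _ _ _ _ phi idfun).
  have eq : phi q' = q.
    by rewrite Eq' ef rmorph_vE rmorph_wE phiC eY eZ eU VE WE -EfQ.
  have ep : phi p' = P by rewrite Ep' !rmE eq !phiC eZ eU PE.
  have ev : phi v' = xa by rewrite Ev' !rmE eq !phiC eZ ep P1 addrC subrK.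
  have ew : phi w' = w by rewrite Ew' !rmE eq !phiC eZ eU ep U2; ring.
  split=> //; rewrite Es' rmorph_sOf rmorphB !ef !ef1 rmorphN ef1 ev ew eq eZ phiC -Eq0.
  have := @sOfK _ t%:MP xa w q (ev1 g xa) q0 (ev2 h xa w) xb (Z - ev1 r xa).
  by apply; rewrite // EZ addrC addKr -El.
move=> E phi psi eqC; rewrite -Eq' => ea eb ey.
have eT : phi x%:MP = phi c%:MP * phi t%:MP by rewrite xE rmorphM.
have ey' : phi xy = phi c%:MP * (1 - phi t%:MP * phi q') by rewrite ey eT; ring.
have eTq : phi (1 - t%:MP * q') = 1 - phi t%:MP * phi q' by rewrite !rmE.
have ep : phi p' = (1 - phi t%:MP * phi q') * (phi c%:MP * phi xu) + phi xz ^+ 2.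
  by rewrite Ep' !rmE.
have ev : phi v' = phi t%:MP * phi xz + (1 - phi t%:MP * phi q') * phi p'.
  by rewrite Ev' !rmE.
have ew : phi w' = phi t%:MP ^+ 2 * (phi c%:MP * phi xu)
    - 2%:R * phi t%:MP * phi xz * phi p' - (1 - phi t%:MP * phi q') * phi p' ^+ 2.
  by rewrite Ew' !rmE.
have eq' : phi q' = phi (ev2 f v' w').
  rewrite Eq' EfQ; apply: rmorph_ev2 => //.
    by rewrite rmorph_vE ey' eT vE_scale -ep -ev rmorphM.
  by rewrite rmorph_wE ey' eT wE_scale -ep -ew rmorphM.
have Eh' : phi q' = phi (ev2 f v' (- ev1 g v'))
    + (phi w' + phi (ev1 g v')) * phi (ev2 h v' w').
  by rewrite eq' Eh rmorphD rmorphM rmorphD.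
have Er' : phi t%:MP ^+ 2 * phi v' - (1 - phi t%:MP * phi (ev2 f v' (- ev1 g v'))) * phi v' ^+ 2
    + (1 - phi t%:MP * phi (ev2 f v' (- ev1 g v'))) ^+ 2 * phi (ev1 g v')
    = phi t%:MP ^+ 3 * phi (ev1 r v').
  have := congr1 phi (Er _ v').
  move: (ev2 f v' (- ev1 g v')) => A1; move: (ev1 g v') (ev1 r v') => A2 A3.
  by rewrite !rmE.
have Ez' := slopeP Eh' Er'.
have Ez1 : phi t%:MP ^+ 3 * phi xz = phi t%:MP ^+ 2 * phi v'
    - (1 - phi t%:MP * phi q') * phi v' ^+ 2 - (1 - phi t%:MP * phi q') ^+ 2 * phi w'.
  by rewrite ev ew ep; ring.
have [S1 S2] : slope (phi t%:MP) (phi v') (phi q') (phi (ev1 g v'))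
      (phi (ev2 f v' (- ev1 g v'))) (phi (ev2 h v' w')) * phi s' = phi xz - phi (ev1 r v')
    /\ phi t%:MP ^+ 3 * phi s' = - (phi w' + phi (ev1 g v')).
  rewrite Es' rmorph_sOf rmorphB; apply: sOfP.
  by rewrite mulrBr Ez1 Ez'; ring.
have ef f' a b a' b' : psi a = phi a' -> psi b = phi b' ->
    psi (ev2 f' a b) = phi (ev2 f' a' b').
  by move=> *; apply: (@rmorph_ev2 _ _ _ _ psi phi).
have eg g' : psi (ev1 g' xa) = phi (ev1 g' v').
  by apply: (@rmorph_ev1 _ _ _ _ psi phi).
have ew1 : psi w = phi w'.
  by rewrite Ew rmorphB rmorphN rmorphM rmorphXn eqC eg eb S2; ring.
have eq1 : psi q = phi q' by rewrite eq' Eq; apply: ef.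
have eq01 : psi q0 = phi (ev2 f v' (- ev1 g v')).
  by rewrite Eq0; apply: ef; rewrite ?rmorphN ?eg.
have eZ : psi Z = phi xz.
  rewrite EZ rmorphD rmorphM El rmorph_slope eqC ea eq1 !eg eq01 eb.
  by rewrite (ef _ _ _ _ _ ea ew1) S1 addrC subrK.
have [P1' P2'] := pOfP Ez1.
have eP : psi P = phi p'.
  rewrite EP rmorph_pOf eqC ea ew1 eq1 eZ; apply: pOfK; first by rewrite ev addrAC subrr add0r.
  by rewrite ew ev ep; ring.
have eU : psi U = phi xu.
  have dcphi : phi d%:MP * phi c%:MP = 1 by rewrite -rmorphM dcE rmorph1.
  rewrite EU rmorphM rmorph_uOf !eqC ew1 eq1 eZ eP -[RHS]mul1r -dcphi -mulrA.
  by congr (_ * _); apply: uOfK; rewrite ?ew ?ep; ring.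
by split=> //; rewrite EY !rmE eq1 !eqC ey'.
Qed.
End UnitC.

(** * The cusp: coordinates adapted to reduction modulo t^2 *)

(* With Q = q + t ^ 2 N, tail is such that slope = 1 - 2 t q + t ^ 2 tail, and corr such
   that y ^ 2 u = b + corr for the b with v = t s + (1 - 5 t q) s ^ 2 + t ^ 2 b. *)
Section CuspCoordinates.
Variables (E : comPzRingType) (t q N : E).

Definition tail e := q ^+ 2 - 2%:R * t * N * (1 - t * q) + t ^+ 4 * N ^+ 2 + t * e.

Definition corr k s := 2%:R * q * s
  - (8%:R * q ^+ 2 - 4%:R * t * q ^+ 3 - t * N * (1 - 2%:R * t * q) ^+ 2) * s ^+ 2
  - t * k - 2%:R * (1 - t * (q + t ^+ 2 * N)) * (1 - 2%:R * t * q) * s * k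
  - t ^+ 2 * (1 - t * (q + t ^+ 2 * N)) * k ^+ 2.

(** Modulo t^2, t z + y z^2 is t s + (1 - 5 t q) s^2, because (1 - t q)(1 - 2 t q)^2 = 1 - 5 t q
    modulo t^2. *)
Lemma corrP k s z : z = (1 - 2%:R * t * q) * s + t ^+ 2 * k ->
  t ^+ 2 * corr k s = t * s + (1 - 5%:R * t * q) * s ^+ 2 
     - t * z - (1 - t * (q + t ^+ 2 * N)) * z ^+ 2.
Proof. by rewrite /corr => ->; ring. Qed.

Lemma slope_tail v g q0 h : slope t v (q + t ^+ 2 * N) g q0 (t ^+ 2 * h)
  = 1 - 2%:R * t * q
    + t ^+ 2 * tail (h * ((2%:R - t * (q + t ^+ 2 * N) - t * q0) * g - v ^+ 2)).
Proof. by rewrite /slope /tail; ring. Qed.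

Definition u2Of Q n m := (1 + t * Q + t ^+ 2 * Q ^+ 2 + t ^+ 3 * Q ^+ 3) ^+ 2 * n
  + (2%:R * Q ^+ 4 - t ^+ 4 * Q ^+ 8) * m.

Lemma u2OfK Q n m u : n = (1 - t * Q) ^+ 2 * u -> m = t ^+ 4 * u -> u2Of Q n m = u.
Proof. by rewrite /u2Of => -> ->; ring. Qed.

(** With a = 1 + t Q + t^2 Q^2 + t^3 Q^3 one has (1 - t Q) a = 1 - t^4 Q^4; squaring this gives the
    Bezout identity for (1 - t Q)^2 and t^4. *)
Lemma u2OfP Q n m : (1 - t * Q) ^+ 2 * m = t ^+ 4 * n ->
  (1 - t * Q) ^+ 2 * u2Of Q n m = n /\ t ^+ 4 * u2Of Q n m = m.
Proof.
rewrite /u2Of => Em; set a := 1 + _ + _ + _; set b := _ - _ * Q ^+ 8.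
have ab : (1 - t * Q) ^+ 2 * a ^+ 2 + b * t ^+ 4 = 1 by rewrite /a /b; ring.
split.
- transitivity ((1 - t * Q) ^+ 2 * a ^+ 2 * n + b * ((1 - t * Q) ^+ 2 * m)); first by ring.
  by rewrite Em -[RHS]mul1r -[X in _ = X * _]ab; ring.
- transitivity (a ^+ 2 * (t ^+ 4 * n) + b * t ^+ 4 * m); first by ring.
  by rewrite -Em -[RHS]mul1r -[X in _ = X * _]ab; ring.
Qed.

(* The ideal (1 - t Q, t ^ 2) is the unit ideal. *)
Lemma eq_of_mul Q a b : (1 - t * Q) * a = (1 - t * Q) * b -> t ^+ 2 * a = t ^+ 2 * b -> a = b.
Proof.
move=> E1 E2; have H c : c = (1 + t * Q) * ((1 - t * Q) * c) + Q ^+ 2 * (t ^+ 2 * c) by ring.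
by rewrite (H a) (H b) E1 E2.
Qed.

(** For y = 1 - t Q and m the last argument of [u2Of], the products y^2 u = n and t^4 u = m are
    compatible because y m = t^2 (p - z^2) and y (p - z^2) = t^2 n. *)
Lemma u2Of_coordinates Q v w z p n :
    (1 - t * Q) * p = v - t * z -> t ^+ 2 * p = (1 - t * Q) * w + v ^+ 2 ->
    t ^+ 2 * n = v - t * z - (1 - t * Q) * z ^+ 2 ->
  let u := u2Of Q n (w + 2%:R * t * z * p + (1 - t * Q) * p ^+ 2) in
  [/\ (1 - t * Q) * (t ^+ 2 * u) + z ^+ 2 = p,
      t ^+ 4 * u = w + 2%:R * t * z * p + (1 - t * Q) * p ^+ 2
    & (1 - t * Q) ^+ 2 * u = n].
Proof.
move=> E1 E2 E3; set m := w + _ + _ => /=; set u := u2Of _ _ _.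
have E4 : (1 - t * Q) * (p - z ^+ 2) = t ^+ 2 * n by rewrite E3 -E1; ring.
have Em : (1 - t * Q) * m = t ^+ 2 * (p - z ^+ 2).
  transitivity ((1 - t * Q) * w + 2%:R * t * z * ((1 - t * Q) * p) + ((1 - t * Q) * p) ^+ 2).
    by rewrite /m; ring.
  by rewrite E1 [t ^+ 2 * (p - _)]mulrBr E2; ring.
have [U1 U2] : (1 - t * Q) ^+ 2 * u = n /\ t ^+ 4 * u = m.
  by apply: u2OfP; rewrite expr2 -mulrA Em mulrCA E4; ring.
split=> //; rewrite -[RHS](subrK (z ^+ 2)); congr (_ + _); apply: (@eq_of_mul Q).
- by rewrite E4 -U1; ring.
- transitivity ((1 - t * Q) * (t ^+ 4 * u)); first by ring.
  by rewrite U2 Em.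
Qed.

End CuspCoordinates.

Section CuspMorphisms.
Variables (E E' : comPzRingType) (phi : {rmorphism E -> E'}) (t q N k s n m e : E).

Lemma rmorph_corr : phi (corr t q N k s) = corr (phi t) (phi q) (phi N) (phi k) (phi s).
Proof. by rewrite /corr !rmE. Qed.

Lemma rmorph_tail : phi (tail t q N e) = tail (phi t) (phi q) (phi N) (phi e).
Proof. by rewrite /tail !rmE. Qed.

Lemma rmorph_u2Of : phi (u2Of t q n m) = u2Of (phi t) (phi q) (phi n) (phi m).
Proof. by rewrite /u2Of !rmE. Qed.

End CuspMorphisms.

Section Cusp.
Variables (S : comNzRingType) (t : S) (Q : {mpoly S[2]}).

(** Modulo t^2 such a polynomial depends on the first variable only, so adding it to the second
    coordinate is a shear. *)
Definition univ_mod (f : {mpoly S[2]}) :=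
  exists (e : {mpoly S[1]}) (k : {mpoly S[2]}), f = ev1 e xa + t%:MP ^+ 2 * k.

Lemma univ_modC s : univ_mod s%:MP.
Proof. by exists s%:MP, 0; rewrite comp_mpolyC mulr0 addr0. Qed.

Lemma univ_modX : univ_mod xa.
Proof. by exists xv, 0; rewrite comp_mpolyXU mulr0 addr0. Qed.

Lemma univ_mod_sqr k : univ_mod (t%:MP ^+ 2 * k).
Proof. by exists 0, k; rewrite rmorph0 add0r. Qed.

Lemma univ_modD f g : univ_mod f -> univ_mod g -> univ_mod (f + g).
Proof.
move=> [e [k ->]] [e' [k' ->]]; exists (e + e'), (k + k').
by rewrite rmorphD /=; ring.
Qed.

Lemma univ_modM f g : univ_mod f -> univ_mod g -> univ_mod (f * g).
Proof.
move=> [e [k ->]] [e' [k' ->]].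
exists (e * e'), (ev1 e xa * k' + k * ev1 e' xa + t%:MP ^+ 2 * k * k').
by rewrite rmorphM /=; ring.
Qed.

Lemma univ_modN f : univ_mod f -> univ_mod (- f).
Proof.
by move=> uf; rewrite -mulN1r -mpolyC1 -mpolyCN; apply: univ_modM => //; apply: univ_modC.
Qed.

Lemma univ_modXn f n : univ_mod f -> univ_mod (f ^+ n).
Proof.
move=> uf; elim: n => [|n IHn]; first exact: univ_modC.
by rewrite exprS; apply: univ_modM.
Qed.

Lemma univ_mod_nat n : univ_mod n%:R.
Proof. by rewrite -mpolyC_nat; exact: univ_modC. Qed.

Lemma univ_mod1 : univ_mod 1.
Proof. exact: univ_modC. Qed.

Lemma univ_mod_comp n f (a : n.-tuple {mpoly S[2]}) :
  (forall i, univ_mod (tnth a i)) -> univ_mod (f \mPo a).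
Proof.
move=> ua; elim/mpoly_ring_ind: f => [s|i|f g uf ug|f g uf ug].
- by rewrite comp_mpolyC; apply: univ_modC.
- by rewrite comp_mpolyXU -tnth_nth.
- by rewrite rmorphD /=; apply: univ_modD.
- by rewrite rmorphM /=; apply: univ_modM.
Qed.

Lemma univ_mod_ev1 f a : univ_mod a -> univ_mod (ev1 f a).
Proof. by move=> ua; apply: univ_mod_comp => -[[|//] i]; rewrite (tnth_nth 0). Qed.

Lemma univ_mod_ev2 f a b : univ_mod a -> univ_mod b -> univ_mod (ev2 f a b).
Proof.
by move=> ua ub; apply: univ_mod_comp => -[[|[|//]] i]; rewrite (tnth_nth 0).
Qed.

Ltac univ_mod_tac := repeat first
  [ assumption | exact: univ_modX | exact: univ_modC | exact: univ_mod_nat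
  | exact: univ_mod1 | exact: univ_mod_sqr | apply: univ_modN | apply: univ_modXn
  | apply: univ_modD | apply: univ_modM | apply: univ_mod_ev1 | apply: univ_mod_ev2 ].

(** [xa] is s and [xb] is the b in v' = t s + (1 - 5 t q) s^2 + t^2 b. Modulo t^2, y' is 1 - t q;
    hence the slope is 1 - 2 t q and the inverse of y'^2 is 1 + 2 t q, the factors in z and u. *)
Lemma presents_cusp :
  exists (q : S) (e : {mpoly S[1]}) (y z u : {mpoly S[2]}),
    presents (venF (t ^+ 3) (t ^+ 2) Q)
      [tuple t%:MP ^+ 2 * y;
             (1 - 2%:R * t%:MP * q%:MP) * xa + t%:MP ^+ 2 * z;
             (1 + 2%:R * t%:MP * q%:MP) * xb + ev1 e xa + t%:MP ^+ 2 * u].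
Proof.
have [q [Qa [Qb EQ]]] := mpoly2_split Q.
(* Both arguments are multiples of t^2, so Q differs from Q(0, 0) by a multiple of t^2. *)
have [M EM] : exists M : {mpoly S[2]}, forall n (v w : {mpoly S[n]}),
    ev2 Q (t%:MP ^+ 2 * v) (t%:MP ^+ 2 * w) = q%:MP + t%:MP ^+ 2 * ev2 M v w.
  exists (xa * ev2 Qa (t%:MP ^+ 2 * xa) (t%:MP ^+ 2 * xb)
          + xb * ev2 Qb (t%:MP ^+ 2 * xa) (t%:MP ^+ 2 * xb)) => n v w.
  rewrite EQ !(rmorphD, rmorphM) /= !comp_ev2 !(rmorphXn, rmorphM) /=.
  rewrite !comp_mpolyC !comp_mpolyXU /=.
  by move: (ev2 Qa _ _) (ev2 Qb _ _) => A1 A2; ring.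
have [f Ef] : exists f : {mpoly S[2]}, forall n (v w : {mpoly S[n]}),
    ev2 f v w = q%:MP + t%:MP ^+ 2 * ev2 M v w.
  by exists (q%:MP + t%:MP ^+ 2 * M) => n v w; rewrite !rmE /= !comp_mpolyC.
(* Order 5 instead of 3 leaves the remainder t^2 r in z, which vanishes modulo t^2. *)
have [g [r Er]] := newton_approx_ev t f 5; have [h Eh] := divided_difference M g.
have [v Ev] : exists v, v = t%:MP * xa + (1 - 5%:R * t%:MP * q%:MP) * xa ^+ 2
    + t%:MP ^+ 2 * xb by eexists.
have [G EG] : exists G, G = ev1 g v by eexists.
have [w Ew] : exists w, w = - G - t%:MP ^+ 3 * xa by eexists.
have [N EN] : exists N, N = ev2 M v w by eexists.
have [q0 Eq0] : exists q0, q0 = q%:MP + t%:MP ^+ 2 * ev2 M v (- G) by eexists.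
have [H EH] : exists H, H = ev2 h v w by eexists.
have [q1 Eq1] : exists q1, q1 = q%:MP + t%:MP ^+ 2 * N by eexists.
have Eqh : q1 = q0 + (w + G) * (t%:MP ^+ 2 * H).
  by rewrite Eq1 Eq0 EN EH Eh -EG; ring.
have [k Ek] : exists k, k = ev1 r v
   + tail t%:MP q%:MP N (H * ((2%:R - t%:MP * q1 - t%:MP * q0) * G - v ^+ 2)) * xa.
  by eexists.
have [Z EZ] : exists Z, Z = (1 - 2%:R * t%:MP * q%:MP) * xa + t%:MP ^+ 2 * k by eexists.
have [P EP] : exists P, P = pOf t%:MP v w q1 Z by eexists.
(* [n] is the value of y'^2 u; [u2Of] recovers u from it and from t^4 u. *)
have [n En] : exists n, n = xb + corr t%:MP q%:MP N k xa by eexists.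
have [U EU] : exists U, U = u2Of t%:MP q1 n
   (w + 2%:R * t%:MP * Z * P + (1 - t%:MP * q1) * P ^+ 2) by eexists.
have [Y EY] : exists Y, Y = t%:MP ^+ 2 * (1 - t%:MP * q1) by eexists.
have El : slope t%:MP v q1 G q0 (t%:MP ^+ 2 * H) * xa = Z - t%:MP ^+ 2 * ev1 r v.
  by rewrite Eq1 slope_tail -Eq1 EZ Ek; ring.
have Ez : t%:MP ^+ 3 * Z = t%:MP ^+ 2 * v - (1 - t%:MP * q1) * v ^+ 2
    - (1 - t%:MP * q1) ^+ 2 * w.
  have Er' := Er _ v; rewrite Ef -EG -Eq0 in Er'.
  rewrite (slopeP Eqh Er').
  transitivity (t%:MP ^+ 5 * ev1 r v + t%:MP ^+ 3 * (slope t%:MP v q1 G q0 (t%:MP ^+ 2 * H) * xa)).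
    by rewrite El; ring.
  by rewrite Ew; ring.
have [P1 P2] := pOfP Ez; rewrite -EP in P1 P2.
have En2 : t%:MP ^+ 2 * n = v - t%:MP * Z - (1 - t%:MP * q1) * Z ^+ 2.
  by rewrite En mulrDr (corrP _ EZ) -Eq1 Ev; ring.
have [PE U2 U3] := u2Of_coordinates P1 P2 En2; rewrite -EU in PE U2 U3.
have xE m : (t ^+ 3)%:MP_[m] = t%:MP ^+ 2 * t%:MP by rewrite rmorphXn exprSr.
have cE m : (t ^+ 2)%:MP_[m] = t%:MP ^+ 2 by rewrite rmorphXn.
have VE : vE (t ^+ 3)%:MP Y Z U = t%:MP ^+ 2 * v.
  by rewrite EY xE vE_scale PE P1 addrC subrK.
have WE : wE (t ^+ 3)%:MP Y Z U = t%:MP ^+ 2 * w.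
  rewrite EY xE wE_scale PE; congr (_ * _).
  transitivity (t%:MP ^+ 4 * U - 2%:R * t%:MP * Z * P - (1 - t%:MP * q1) * P ^+ 2).
    by ring.
  by rewrite U2; ring.
have presY : presents (venF (t ^+ 3) (t ^+ 2) Q) [tuple Y; Z; U].
  have [q' Eq'] : exists q', q' = ev2 Q (vE (t ^+ 3)%:MP xy xz xu) (wE (t ^+ 3)%:MP xy xz xu).
    by eexists.
  have [p' Ep'] : exists p', p' = (1 - t%:MP * q') * (t%:MP ^+ 2 * xu) + xz ^+ 2 by eexists.
  have [v' Ev'] : exists v', v' = t%:MP * xz + (1 - t%:MP * q') * p' by eexists.
  have [w' Ew'] : exists w', w' = t%:MP ^+ 2 * (t%:MP ^+ 2 * xu)
    - 2%:R * t%:MP * xz * p' - (1 - t%:MP * q') * p' ^+ 2 by eexists.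
  have [N' EN'] : exists N', N' = ev2 M v' w' by eexists.
  have [G' EG'] : exists G', G' = ev1 g v' by eexists.
  have [K' EK'] : exists K', K' = ev2 M v' (- G') by eexists.
  have [q0' Eq0'] : exists q0', q0' = q%:MP + t%:MP ^+ 2 * K' by eexists.
  have [H' EH'] : exists H', H' = ev2 h v' w' by eexists.
  have [r' Er'] : exists r', r' = ev1 r v' by eexists.
  have [s' Es'] : exists s', s' = sOf t%:MP v' w' q' G' q0' (t%:MP ^+ 2 * H')
    (xz - t%:MP ^+ 2 * r') by eexists.
  have [k' Ek'] : exists k', k' = r' + tail t%:MP q%:MP N'
    (H' * ((2%:R - t%:MP * q' - t%:MP * q0') * G' - v' ^+ 2)) * s' by eexists.
  have [b' Eb'] : exists b', b' = (1 - t%:MP * q') ^+ 2 * xu - corr t%:MP q%:MP N' k' s'.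
    by eexists.
  apply: (@presents_venF _ _ _ _ _ _ _ s' b').
  - by rewrite VE WE EM -EN -Eq1 EY xE cE; ring.
  - move=> phi phiC eY eZ eU.
    have ef f' a b : phi (ev2 f' a b) = ev2 f' (phi a) (phi b).
      by apply: (@rmorph_ev2 _ _ _ _ phi idfun).
    have ef1 f' a : phi (ev1 f' a) = ev1 f' (phi a).
      by apply: (@rmorph_ev1 _ _ _ _ phi idfun).
    have eq : phi q' = q1.
      by rewrite Eq' ef rmorph_vE rmorph_wE phiC eY eZ eU VE WE EM -EN -Eq1.
    have ep : phi p' = P by rewrite Ep' !rmE eq !phiC eZ eU PE.
    have ev : phi v' = v by rewrite Ev' !rmE eq !phiC eZ ep P1 addrC subrK.
    have ew : phi w' = w.
      rewrite Ew' !rmE eq !phiC eZ eU ep.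
      transitivity (t%:MP ^+ 4 * U - 2%:R * t%:MP * Z * P - (1 - t%:MP * q1) * P ^+ 2).
        by ring.
      by rewrite U2; ring.
    have eN : phi N' = N by rewrite EN' ef ev ew EN.
    have eG : phi G' = G by rewrite EG' ef1 ev EG.
    have eq0 : phi q0' = q0.
      by rewrite Eq0' EK' rmorphD rmorphM ef rmorphN eG ev rmorphXn !phiC Eq0.
    have eH : phi H' = H by rewrite EH' ef ev ew EH.
    have er : phi r' = ev1 r v by rewrite Er' ef1 ev.
    have es : phi s' = xa.
      rewrite Es' rmorph_sOf !rmE !phiC ev ew eq eG eq0 eH eZ er.
      by apply: sOfK; rewrite // El.
    have ek : phi k' = k.
      by rewrite Ek' rmorphD rmorphM rmorph_tail !rmE !phiC ev eq eN eG eq0 eH er es Ek.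
    split=> //; rewrite Eb' rmorphB rmorph_corr !rmE !phiC eq eN ek es eU U3 En.
    by rewrite addrK.
  move=> E phi psi eqC; rewrite -Eq' => ea eb ey.
  have ey' : phi xy = phi t%:MP ^+ 2 * (1 - phi t%:MP * phi q').
    by rewrite ey xE cE !rmE; ring.
  have ep : phi p' = (1 - phi t%:MP * phi q') * (phi t%:MP ^+ 2 * phi xu) + phi xz ^+ 2.
    by rewrite Ep' !rmE.
  have ev : phi v' = phi t%:MP * phi xz + (1 - phi t%:MP * phi q') * phi p'.
    by rewrite Ev' !rmE.
  have ew : phi w' = phi t%:MP ^+ 2 * (phi t%:MP ^+ 2 * phi xu)
      - 2%:R * phi t%:MP * phi xz * phi p' - (1 - phi t%:MP * phi q') * phi p' ^+ 2.
    by rewrite Ew' !rmE.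
  have ef f' a1 a2 a1' a2' : psi a1 = phi a1' -> psi a2 = phi a2' ->
      psi (ev2 f' a1 a2) = phi (ev2 f' a1' a2').
    by move=> *; apply: (@rmorph_ev2 _ _ _ _ psi phi).
  have eq' : phi q' = phi q%:MP + phi t%:MP ^+ 2 * phi N'.
    transitivity (phi (ev2 Q (t%:MP ^+ 2 * v') (t%:MP ^+ 2 * w'))).
      rewrite Eq'; apply: rmorph_ev2 => //.
        by rewrite rmorph_vE ey' xE rmorphM rmorphXn vE_scale -ep -ev rmorphM rmorphXn.
      by rewrite rmorph_wE ey' xE rmorphM rmorphXn wE_scale -ep -ew rmorphM rmorphXn.
    by rewrite EM -EN' !rmE.
  have eq0 : phi q0' = phi q%:MP + phi t%:MP ^+ 2 * phi K' by rewrite Eq0' !rmE.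
  have Eh' : phi q' = phi q0' + (phi w' + phi G') * (phi t%:MP ^+ 2 * phi H').
    have eN2 : phi N' = phi K' + (phi w' + phi G') * phi H'.
      by rewrite EN' Eh -EG' -EK' -EH' !rmE.
    by rewrite eq' eq0 eN2; ring.
  have Er2 : phi t%:MP ^+ 2 * phi v' - (1 - phi t%:MP * phi q0') * phi v' ^+ 2
      + (1 - phi t%:MP * phi q0') ^+ 2 * phi G' = phi t%:MP ^+ 5 * phi r'.
    have := congr1 phi (Er _ v'); rewrite Ef -EG' -EK' -Eq0' -Er'.
    by rewrite !rmE.
  have Ez' := slopeP Eh' Er2.
  have Ez1 : phi t%:MP ^+ 3 * phi xz = phi t%:MP ^+ 2 * phi v'
      - (1 - phi t%:MP * phi q') * phi v' ^+ 2 - (1 - phi t%:MP * phi q') ^+ 2 * phi w'.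
    by rewrite ev ew ep; ring.
  have [S1 S2] : slope (phi t%:MP) (phi v') (phi q') (phi G') (phi q0')
      (phi t%:MP ^+ 2 * phi H') * phi s' = phi xz - phi t%:MP ^+ 2 * phi r'
    /\ phi t%:MP ^+ 3 * phi s' = - (phi w' + phi G').
    have -> : phi s' = sOf (phi t%:MP) (phi v') (phi w') (phi q') (phi G') (phi q0')
      (phi t%:MP ^+ 2 * phi H') (phi xz - phi t%:MP ^+ 2 * phi r').
      by rewrite Es' rmorph_sOf !rmE.
    by apply: sOfP; rewrite mulrBr Ez1 Ez'; ring.
  have ek : phi k' = phi r' + tail (phi t%:MP) (phi q%:MP) (phi N')
    (phi H' * ((2%:R - phi t%:MP * phi q' - phi t%:MP * phi q0') * phi G'
       - phi v' ^+ 2)) * phi s'.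
    by rewrite Ek' rmorphD rmorphM rmorph_tail !rmE.
  have ez : phi xz = (1 - 2%:R * phi t%:MP * phi q%:MP) * phi s' + phi t%:MP ^+ 2 * phi k'.
    move: S1; rewrite {1}eq' slope_tail -eq' => S1.
    by rewrite -[LHS](subrK (phi t%:MP ^+ 2 * phi r')) -S1 ek; ring.
  have eb1 : phi b' = (1 - phi t%:MP * phi q') ^+ 2 * phi xu
      - corr (phi t%:MP) (phi q%:MP) (phi N') (phi k') (phi s').
    by rewrite Eb' rmorphB rmorph_corr !rmE.
  have evv : psi v = phi v'.
    rewrite Ev !rmE !eqC ea eb eb1 mulrBr (corrP _ ez) -eq' ev ep; ring.
  have eG : psi G = phi G' by rewrite EG EG'; apply: (@rmorph_ev1 _ _ _ _ psi phi).
  have er : psi (ev1 r v) = phi r' by rewrite Er'; apply: (@rmorph_ev1 _ _ _ _ psi phi).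
  have ew1 : psi w = phi w'.
    by rewrite Ew !rmE eqC ea S2 eG; ring.
  have eN : psi N = phi N' by rewrite EN EN'; apply: ef.
  have eq1 : psi q1 = phi q' by rewrite Eq1 !rmE !eqC eN.
  have eq01 : psi q0 = phi q0'.
    rewrite Eq0 eq0 EK' rmorphD rmorphM rmorphXn !eqC.
    by congr (_ + _ * _); apply: ef => //; rewrite !rmorphN eG.
  have eH : psi H = phi H' by rewrite EH EH'; apply: ef.
  have ek1 : psi k = phi k'.
    by rewrite Ek ek rmorphD rmorphM rmorph_tail er !rmE !eqC ea eN eH eq1 eq01 eG evv.
  have eZ : psi Z = phi xz by rewrite EZ ez !rmE !eqC ea ek1.
  have eP : psi P = phi p'.
    rewrite EP rmorph_pOf eqC evv ew1 eq1 eZ; apply: pOfK; first by rewrite ev addrAC subrr add0r.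
    by rewrite ew ev ep; ring.
  have en : psi n = (1 - phi t%:MP * phi q') ^+ 2 * phi xu.
    by rewrite En rmorphD rmorph_corr !eqC ea eb eb1 eN ek1 subrK.
  split=> //; first by rewrite EY !rmE !eqC eq1 ey'.
  rewrite EU rmorph_u2Of eqC en eq1; apply: u2OfK => //.
  by rewrite !rmE ew1 !eqC eZ eP eq1 ew; ring.
(* Modulo t^2 the correction to [xb] in [n] depends on [xa] alone; this produces the univariate
   [e]. *)
have uv : univ_mod v by rewrite Ev; univ_mod_tac.
have uG : univ_mod G by rewrite EG; univ_mod_tac.
have uw : univ_mod w by rewrite Ew; univ_mod_tac.
have uN : univ_mod N by rewrite EN; univ_mod_tac.
have uH : univ_mod H by rewrite EH; univ_mod_tac.
have uq1 : univ_mod q1 by rewrite Eq1; univ_mod_tac.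
have uq0 : univ_mod q0 by rewrite Eq0; univ_mod_tac.
have uk : univ_mod k by rewrite Ek /tail; univ_mod_tac.
have uc : univ_mod (corr t%:MP q%:MP N k xa) by rewrite /corr; univ_mod_tac.
have [e [k1 Ek1]] : univ_mod ((1 + 2%:R * t%:MP * q%:MP) * corr t%:MP q%:MP N k xa).
  by univ_mod_tac.
exists q, e, (1 - t%:MP * q1), k.
(* 1 + t q1 + t^2 q1^2 + t^3 q1^3 = 1 + t q + t^2 B, and squaring isolates the factor 1 + 2 t q. *)
pose B : {mpoly S[2]} := t%:MP * N + q1 ^+ 2 + t%:MP * q1 ^+ 3.
exists (k1 + (q%:MP ^+ 2 + 2%:R * (1 + t%:MP * q%:MP) * B + t%:MP ^+ 2 * B ^+ 2) * n
  + (2%:R * q1 ^+ 4 - t%:MP ^+ 4 * q1 ^+ 8) * (t%:MP ^+ 2 * U)).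
rewrite -EY -EZ; congr presents: presY; congr [tuple _; _; _].
transitivity ((1 + 2%:R * t%:MP * q%:MP) * xb
    + (1 + 2%:R * t%:MP * q%:MP) * corr t%:MP q%:MP N k xa
    + t%:MP ^+ 2 * ((q%:MP ^+ 2 + 2%:R * (1 + t%:MP * q%:MP) * B + t%:MP ^+ 2 * B ^+ 2) * n
    + (2%:R * q1 ^+ 4 - t%:MP ^+ 4 * q1 ^+ 8) * (t%:MP ^+ 2 * U))).
  rewrite {1}EU /u2Of -U2 -mulrDr -En /B Eq1; ring.
by rewrite Ek1; ring.
Qed.

End Cusp.

(* Uses the matrix [[1 + d, d^2], [-d^2, 1 - d + d^2 - d^3]] of determinant 1, d = 2 t q. *)
Lemma presents_cusp_normal (S : comNzRingType) (t : S) (Q : {mpoly S[2]}) :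
  exists y z u : {mpoly S[2]},
    presents (venF (t ^+ 3) (t ^+ 2) Q)
      [tuple t%:MP ^+ 2 * y; xa + t%:MP ^+ 2 * z; xb + t%:MP ^+ 2 * u].
Proof.
have [q [e [y [z [u presY]]]]] := presents_cusp t Q.
have [d Ed] : exists d : {mpoly S[2]}, d = 2%:R * t%:MP * q%:MP by eexists.
rewrite -Ed in presY.
have dC (T : 2.-tuple {mpoly S[2]}) : d \mPo T = d.
  by rewrite Ed !rmE /= !comp_mpolyC.
(* As t^2 divides d^2, (1 - d) a is [xa] modulo t^2. In (1 + d) b + e(a) the term - (1 - d) e(a) of
   [b] cancels e(a) modulo t^2. *)
have [a Ea] : exists a, a = (1 + d) * xa + d ^+ 2 * xb by eexists.
have [b Eb] : exists b, b = (1 - d + d ^+ 2 - d ^+ 3) * xb - d ^+ 2 * xa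
    - (1 - d) * ev1 e a by eexists.
(* [b1] undoes the shear, and [a'], [b'] apply the inverse matrix to ([xa], [b1]). *)
have [b1 Eb1] : exists b1, b1 = xb + (1 - d) * ev1 e xa by eexists.
have [a' Ea'] : exists a', a' = (1 - d + d ^+ 2 - d ^+ 3) * xa - d ^+ 2 * b1 by eexists.
have [b' Eb'] : exists b', b' = d ^+ 2 * xa + (1 + d) * b1 by eexists.
have eX (i : 'I_2) : i = Ordinal (isT : 0 < 2)%N \/ i = Ordinal (isT : 1 < 2)%N.
  by case: i => -[|[|//]] i; [left|right]; apply: val_inj.
have aK : a \mPo [tuple a'; b'] = xa.
  by rewrite Ea !rmE /= dC !comp_mpolyXU /= Ea' Eb'; ring.
have b1K : b1 \mPo [tuple a; b] = (1 - d + d ^+ 2 - d ^+ 3) * xb - d ^+ 2 * xa.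
  by rewrite Eb1 !rmE /= dC comp_ev1 !comp_mpolyXU /= Eb; ring.
have pres2 : presents (venF (t ^+ 3) (t ^+ 2) Q)
    [tuple tnth [tuple t%:MP ^+ 2 * y; (1 - d) * xa + t%:MP ^+ 2 * z;
       (1 + d) * xb + ev1 e xa + t%:MP ^+ 2 * u] i \mPo [tuple a; b] | i < 3].
  apply: (@presents_comp _ _ _ _ [tuple a'; b']) => // i.
    case: (eX i) => ->; rewrite (tnth_nth 0) //=.
    by rewrite Eb !rmE /= dC comp_ev1 aK !comp_mpolyXU /= Ea' Eb' Eb1; ring.
  case: (eX i) => ->; rewrite (tnth_nth 0) /=.
    by rewrite Ea' !rmE /= dC b1K !comp_mpolyXU /= Ea; ring.
  by rewrite Eb' !rmE /= dC b1K !comp_mpolyXU /= Ea; ring.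
exists (y \mPo [tuple a; b]), (z \mPo [tuple a; b] - 2%:R ^+ 2 * q%:MP ^+ 2 * xa
   + (1 - d) * 2%:R ^+ 2 * q%:MP ^+ 2 * xb),
  (u \mPo [tuple a; b] - 2%:R ^+ 2 * q%:MP ^+ 2 * ((1 + d) * xa + d ^+ 2 * xb)
    + 2%:R ^+ 2 * q%:MP ^+ 2 * ev1 e a).
congr presents: pres2.
apply: eq_from_tnth => -[[|[|[|//]]] i]; rewrite tnth_mktuple !(tnth_nth 0) /=.
- by rewrite !rmE /= comp_mpolyC.
- by rewrite !rmE /= dC !comp_mpolyC !comp_mpolyXU /= Ea Ed; ring.
- rewrite !rmE /= dC comp_ev1 !comp_mpolyC !comp_mpolyXU /=.
  by move: (ev1 e a) Eb => ea ->; rewrite Ed; ring.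
Qed.

(** * Descent from C[t] to C[t^2, t^3] *)

(* The ring C[t^2, t^3] sits in C[t] as C + t^2 C[t]. *)
Section Descent.
Variable C : idomainType.
Local Notation A := {poly C}.
Local Notation t := ('X : A).
Local Notation j := (map_mpoly (@polyC C)).

Lemma mpoly_decomp n (g : {mpoly A[n]}) :
  exists g0 g1 g2, g = j g0 + t%:MP * j g1 + t%:MP ^+ 2 * g2.
Proof.
elim/mpoly_ring_ind: g => [s|i|_ _ [f0 [f1 [f2 ->]]] [g0 [g1 [g2 ->]]]
    |_ _ [f0 [f1 [f2 ->]]] [g0 [g1 [g2 ->]]]].
- exists (s`_0)%:MP, (s`_1)%:MP, (drop_poly 2 s)%:MP.
  rewrite !map_mpolyC -rmorphXn -!rmorphM -!rmorphD /=; congr _%:MP.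
  apply/polyP => i; rewrite !coefD coefC coefXM coefXnM coefC coef_drop_poly.
  by case: i => [|[|i]] //=; rewrite ?addr0 ?add0r ?subn0 ?subSS ?subn0 ?addn2.
- by exists 'X_i, 0, 0; rewrite !rmorph0 !mulr0 !addr0 map_mpolyX.
- exists (f0 + g0), (f1 + g1), (f2 + g2); rewrite !(rmorphD (map_mpoly _)) /=.
  by move: t%:MP (j f0) (j f1) (j g0) (j g1) => T a b c d; ring.
- exists (f0 * g0), (f0 * g1 + f1 * g0), (j f0 * g2 + f2 * j g0 + j f1 * j g1
    + t%:MP * (j f1 * g2 + f2 * j g1) + t%:MP ^+ 2 * f2 * g2).
  rewrite (rmorphM (map_mpoly _)) (rmorphD (map_mpoly _)) !(rmorphM (map_mpoly _)) /=.
  by move: t%:MP (j f0) (j f1) (j g0) (j g1) => T a b c d; ring.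
Qed.

Lemma mcoeff_decomp n (f0 f1 : {mpoly C[n]}) (f2 : {mpoly A[n]}) m :
  (j f0 + t%:MP * j f1 + t%:MP ^+ 2 * f2)@_m
    = (f0@_m)%:P + t * (f1@_m)%:P + t ^+ 2 * f2@_m.
Proof.
have -> : t%:MP ^+ 2 = (t ^+ 2)%:MP_[n] by rewrite rmorphXn.
by rewrite 2!mcoeffD (mcoeffCM t) (mcoeffCM (t ^+ 2)) 2!mcoeff_map_mpoly.
Qed.

Lemma mpoly_decomp_inj n (f0 f1 g0 g1 : {mpoly C[n]}) (f2 g2 : {mpoly A[n]}) :
    j f0 + t%:MP * j f1 + t%:MP ^+ 2 * f2 = j g0 + t%:MP * j g1 + t%:MP ^+ 2 * g2 ->
  f0 = g0 /\ f1 = g1.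
Proof.
move=> E; split; apply/mpolyP => m; have := congr1 (mcoeff m) E;
  rewrite 2!mcoeff_decomp => /(congr1 (fun p : A => (p`_0, p`_1)));
  by rewrite !coefD !coefC !coefXM !coefXnM /= !coefC !addr0 !add0r => -[].
Qed.

Lemma comp_mpoly_mod n k (f : {mpoly C[n]}) (Y0 : n.-tuple {mpoly C[k]})
    (Y : n.-tuple {mpoly A[k]}) :
    (forall i, exists r, tnth Y i = j (tnth Y0 i) + t%:MP ^+ 2 * r) ->
  exists r, j f \mPo Y = j (f \mPo Y0) + t%:MP ^+ 2 * r.
Proof.
move=> YE; elim/mpoly_ring_ind: f => [s|i|f g [r er] [r' er']|f g [r er] [r' er']].
- by exists 0; rewrite map_mpolyC !comp_mpolyC map_mpolyC mulr0 addr0.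
- have [r er] := YE i; exists r.
  by rewrite map_mpolyX !comp_mpolyXU -!tnth_nth.
- exists (r + r'); rewrite (rmorphD (map_mpoly _)) (rmorphD (comp_mpoly Y)) /= er er'.
  rewrite (rmorphD (comp_mpoly Y0)) (rmorphD (map_mpoly _)) /=.
  by move: (t%:MP) (j _) (j _) => T a b; ring.
- exists (j (f \mPo Y0) * r' + r * j (g \mPo Y0) + t%:MP ^+ 2 * r * r').
  rewrite (rmorphM (map_mpoly _)) (rmorphM (comp_mpoly Y)) /= er er'.
  rewrite (rmorphM (comp_mpoly Y0)) (rmorphM (map_mpoly _)) /=.
  by move: (t%:MP) (j _) (j _) => T a b; ring.
Qed.

(** Modulo y, f equals f(0, z, u), which vanishes by hypothesis. *)
Lemma factor_xy (f : {mpoly C[3]}) :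
  f \mPo [tuple 0; xa; xb] = 0 -> exists g, f = xy * g.
Proof.
move=> f0; have [g Eg] : exists g, f = f \mPo [tuple 0; xz; xu] + xy * g.
  elim/mpoly_ring_ind: f {f0} => [s|i|f g [r er] [r' er']|f g [r er] [r' er']].
  - by exists 0; rewrite comp_mpolyC mulr0 addr0.
  - rewrite comp_mpolyXU; case: i => -[|[|[|//]]] i /=; [exists 1|exists 0|exists 0];
    rewrite ?mulr1 ?mulr0 ?addr0 ?add0r; congr 'X_ _; exact: val_inj.
  - by exists (r + r'); rewrite rmorphD /= {1}er {1}er'; ring.
  - exists (ev3 f 0 xz xu * r' + r * ev3 g 0 xz xu + xy * r * r').
    by rewrite rmorphM /= {1}er {1}er'; ring.
exists g; rewrite {1}Eg.
suff -> : f \mPo [tuple 0; xz; xu] = 0 by rewrite add0r.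
have := congr1 (comp_mpoly [tuple xz; xu]) f0; rewrite comp_mpolyA rmorph0 => E; rewrite -[RHS]E.
congr (f \mPo _); apply: eq_from_tnth => -[[|[|[|//]]] i];
  by rewrite tnth_mktuple !(tnth_nth 0) /= ?rmorph0 ?comp_mpolyXU /=.
Qed.

Section Map.
Variables (S : comNzRingType) (iota : {rmorphism S -> A}).
Hypothesis iota_inj : injective iota.
Hypothesis iota_im : forall s, exists c a, iota s = c%:P + t ^+ 2 * a.
Hypothesis iota_onto : forall c a, exists s, iota s = c%:P + t ^+ 2 * a.
Local Notation m := (map_mpoly iota).

Lemma map_mpoly_inj n : injective (map_mpoly iota : {mpoly S[n]} -> _).
Proof.
move=> f g E; apply/mpolyP => k; apply: iota_inj.
by rewrite -!mcoeff_map_mpoly E.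
Qed.

Lemma map_mpoly_im n (g : {mpoly S[n]}) : exists g0 g2, m g = j g0 + t%:MP ^+ 2 * g2.
Proof.
elim/mpoly_ring_ind: g => [s|i|f g [f0 [f2 Ef]] [g0 [g2 Eg]]|f g [f0 [f2 Ef]] [g0 [g2 Eg]]].
- have [c [a Es]] := iota_im s; exists c%:MP, a%:MP.
  by rewrite !map_mpolyC /= Es mpolyCD mpolyCM rmorphXn.
- by exists 'X_i, 0; rewrite !map_mpolyX mulr0 addr0.
- exists (f0 + g0), (f2 + g2); rewrite !(rmorphD (map_mpoly _)) /= Ef Eg.
  by move: (t%:MP) (j _) (j _) => T a b; ring.
- exists (f0 * g0), (j f0 * g2 + f2 * j g0 + t%:MP ^+ 2 * f2 * g2).
  rewrite !(rmorphM (map_mpoly _)) /= Ef Eg.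
  by move: (t%:MP) (j _) (j _) => T a b; ring.
Qed.

Lemma map_mpoly_sqr n (g : {mpoly A[n]}) : exists f, m f = t%:MP ^+ 2 * g.
Proof.
elim/mpolyind: g => [|a k g _ _ [f Ef]]; first by exists 0; rewrite !rmorph0 mulr0.
have [s Es] := iota_onto 0 a.
exists (s *: 'X_[k] + f); rewrite (rmorphD (map_mpoly _)) /= map_mpolyZ map_mpolyX Ef /= Es.
by rewrite add0r mulrDr -scalerA -!mul_mpolyC rmorphXn.
Qed.

Lemma map_mpoly_onto n (g0 : {mpoly C[n]}) (g2 : {mpoly A[n]}) :
  exists g, m g = j g0 + t%:MP ^+ 2 * g2.
Proof.
have [f2 E2] := map_mpoly_sqr g2.
suff [f0 E0] : exists f, m f = j g0.
  by exists (f0 + f2); rewrite (rmorphD (map_mpoly _)) /= E0 E2.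
elim/mpoly_ring_ind: g0 => [c|i|f g [f' Ef] [g' Eg]|f g [f' Ef] [g' Eg]].
- have [s Es] := iota_onto c 0; exists s%:MP.
  by rewrite !map_mpolyC /= Es mulr0 addr0.
- by exists 'X_i; rewrite !map_mpolyX.
- by exists (f' + g'); rewrite !(rmorphD (map_mpoly _)) /= Ef Eg.
- by exists (f' * g'); rewrite !(rmorphM (map_mpoly _)) /= Ef Eg.
Qed.

(** [iota] identifies S with C + t^2 C[t]. A cofactor or preimage over C[t] descends once its
    t-linear part is gone; as F is y modulo t^2, this part is zero for cofactors and can be removed
    from preimages by a multiple of F. *)
Lemma presents_descent (F : {mpoly S[3]}) (G : {mpoly A[3]}) (y z u : {mpoly A[2]}) :
    m F = j xy + t%:MP ^+ 2 * G ->
    presents (m F) [tuple t%:MP ^+ 2 * y; xa + t%:MP ^+ 2 * z; xb + t%:MP ^+ 2 * u] ->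
  exists Y, presents F Y.
Proof.
set Y := [tuple _; _; _] => EF [FY kerY surjY].
have jX n (i : 'I_n) : j 'X_i = 'X_i by rewrite map_mpolyX.
have [Ys EYs] : exists Ys : 3.-tuple {mpoly S[2]}, [tuple m (tnth Ys i) | i < 3] = Y.
  have [ys Ey] := map_mpoly_onto 0 y; have [zs Ez] := map_mpoly_onto xa z.
  have [us Eu] := map_mpoly_onto xb u; exists [tuple ys; zs; us].
  apply: eq_from_tnth => -[[|[|[|//]]] i]; rewrite tnth_mktuple !(tnth_nth 0) /=.
  - by rewrite Ey rmorph0 add0r.
  - by rewrite Ez jX.
  - by rewrite Eu jX.
have mY f : m (f \mPo Ys) = m f \mPo Y by rewrite map_comp_mpoly EYs.
exists Ys; split=> [|g gY|f].
- by apply: map_mpoly_inj; rewrite mY FY rmorph0.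
- have /kerY[h Eg'] : m g \mPo Y = 0 by rewrite -mY gY rmorph0.
  have [h0 [h1 [h2 E]]] := mpoly_decomp h.
  have [g0 [g2 Eg]] := map_mpoly_im g.
  (* The coefficient of t in h F is h1 y; it is zero on the right, and C[y, z, u] is a domain. *)
  have : j (h0 * xy) + t%:MP * j (h1 * xy) + t%:MP ^+ 2 * (h2 * m F + (j h0 + t%:MP * j h1) * G)
     = j g0 + t%:MP * j 0 + t%:MP ^+ 2 * g2.
    rewrite rmorph0 mulr0 addr0 -Eg Eg' E EF !(rmorphM (map_mpoly _)) /=.
    by move: (t%:MP) (j h0) (j h1) (j _) => T a b c; ring.
  move/mpoly_decomp_inj => [_ /eqP]; rewrite mulf_eq0 => /orP[/eqP h10|/eqP xy0]; last first.
    have := congr1 (mcoeff U_(@Ordinal 3 0 isT)) xy0.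
    by rewrite mcoeffX eqxx mcoeff0 => /eqP; rewrite oner_eq0.
  have [hs Ehs] := map_mpoly_onto h0 h2; exists hs; apply: map_mpoly_inj.
  by rewrite Eg' (rmorphM (map_mpoly _)) /= Ehs E h10 rmorph0 mulr0 addr0.
have [b Eb] := surjY (m f).
have [b0 [b1 [b2 E]]] := mpoly_decomp b.
have YE i : exists r, tnth Y i = j (tnth [tuple 0; xa; xb] i) + t%:MP ^+ 2 * r.
  case: i => -[|[|[|//]]] i; rewrite !(tnth_nth 0) /=.
  - by exists y; rewrite rmorph0 add0r.
  - by exists z; rewrite jX.
  - by exists u; rewrite jX.
have [r0 E0] := comp_mpoly_mod b0 YE; have [r1 E1] := comp_mpoly_mod b1 YE.
have [f0 [f2 Ef]] := map_mpoly_im f.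
(* [Y] is (0, [xa], [xb]) modulo t^2, so the coefficient of t in b(Y) is b1(0, [xa], [xb]), which
   must vanish. *)
have : j (ev3 b0 0 xa xb) + t%:MP * j (ev3 b1 0 xa xb)
    + t%:MP ^+ 2 * (r0 + t%:MP * r1 + (b2 \mPo Y)) = j f0 + t%:MP * j 0 + t%:MP ^+ 2 * f2.
  rewrite rmorph0 mulr0 addr0 -Ef -Eb E 2!(rmorphD (comp_mpoly Y)) /=.
  rewrite 2!(rmorphM (comp_mpoly Y)) (rmorphXn (comp_mpoly Y)) /= comp_mpolyC E0 E1.
  by move: (t%:MP) (j _) (j _) (b2 \mPo Y) => T a c d; ring.
move/mpoly_decomp_inj => [_ /factor_xy[g Eg]].
(* Since b1 = y g, subtracting t g F from b removes its t-linear part and leaves the value at [Y]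
   unchanged. *)
have [bs Ebs] := map_mpoly_onto b0 (b2 - t%:MP * j g * G).
exists bs; apply: map_mpoly_inj; rewrite mY -Eb.
have -> : m bs = b - t%:MP * j g * m F.
  rewrite Ebs E EF Eg (rmorphM (map_mpoly _)) /=.
  by move: (t%:MP) (j b0) (j g) (j xy) => T a c d; ring.
by rewrite rmorphB rmorphM /= FY mulr0 subr0.
Qed.
End Map.

End Descent.

(** * The coordinate ring of the cusp as C[t^2, t^3] *)

Section CuspRing.
Variable C : idomainType.

Definition cusp_param (i : 'I_2) : {poly C} := if val i == 0%N then 'X^3 else 'X^2.
Definition cusp_ev : {mpoly C[2]} -> {poly C} := mmap (@polyC C) cusp_param.
HB.instance Definition _ := GRing.RMorphism.on cusp_ev.

Lemma cusp_evC c : cusp_ev c%:MP = c%:P.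
Proof. exact: mmapC. Qed.

Lemma cusp_evx : cusp_ev xa = 'X^3.
Proof. by rewrite /cusp_ev mmapX mmap1U. Qed.

Lemma cusp_evc : cusp_ev xb = 'X^2.
Proof. by rewrite /cusp_ev mmapX mmap1U. Qed.

Lemma cusp_ev_eq : cusp_ev (xa ^+ 2 - xb ^+ 3) = 0.
Proof. by rewrite rmorphB !rmorphXn /= cusp_evx cusp_evc -!exprM subrr. Qed.

Lemma cusp_ev_horner (p : {poly C}) : cusp_ev (horner_alg xb p) = p \Po 'X^2.
Proof.
elim/poly_ind: p => [|p c IHp]; first by rewrite !rmorph0.
rewrite !(rmorphD, rmorphM) /= horner_algX horner_algC IHp cusp_evc comp_polyX comp_polyC.
by rewrite -mul_mpolyC mulr1 cusp_evC.
Qed.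

Lemma cusp_normal_form (f : {mpoly C[2]}) : exists a b h,
  f = horner_alg xb a + xa * horner_alg xb b + h * (xa ^+ 2 - xb ^+ 3).
Proof.
elim/mpoly_ring_ind: f => [s|i|_ _ [a [b [h ->]]] [a' [b' [h' ->]]]
    |_ _ [a [b [h ->]]] [a' [b' [h' ->]]]].
- exists s%:P, 0, 0; rewrite horner_algC rmorph0 mulr0 mul0r !addr0.
  by rewrite -mul_mpolyC mulr1.
- case: i => -[|[|//]] i; [exists 0, 1, 0|exists 'X, 0, 0].
    by rewrite rmorph0 rmorph1 mulr1 mul0r add0r addr0; congr 'X_ _; exact: val_inj.
  by rewrite rmorph0 horner_algX mulr0 mul0r !addr0; congr 'X_ _; exact: val_inj.
- by exists (a + a'), (b + b'), (h + h'); rewrite !(rmorphD (horner_alg _)); ring.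
(* x^2 is replaced by c^3, whence the term with ['X^3]. *)
- exists (a * a' + b * b' * 'X^3), (a * b' + b * a').
  exists (horner_alg xb b * horner_alg xb b'
    + h * (horner_alg xb a' + xa * horner_alg xb b' + h' * (xa ^+ 2 - xb ^+ 3))
    + (horner_alg xb a + xa * horner_alg xb b) * h').
  rewrite !(rmorphD (horner_alg _)) !(rmorphM (horner_alg _)) /=.
  rewrite !horner_algX.
  by move: (horner_alg xb a) (horner_alg xb b) (horner_alg xb a') (horner_alg xb b')
    => A1 A2 A3 A4; ring.
Qed.

(** The image a(t^2) + t^3 b(t^2) of the normal form a(c) + x b(c) separates into even and odd
    degrees, so a and b vanish with it. *)
Lemma cusp_ev_ker f : cusp_ev f = 0 -> exists h, f = h * (xa ^+ 2 - xb ^+ 3).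
Proof.
have [a [b [h ->]]] := cusp_normal_form f.
rewrite rmorphD !rmorphM /= cusp_ev_eq mulr0 addr0 rmorphD rmorphM /=.
rewrite cusp_evx !cusp_ev_horner => E; exists h.
suff [-> ->] : a = 0 /\ b = 0 by rewrite !rmorph0 mulr0 !add0r.
have coef2 (p : {poly C}) i : (p \Po 'X^2)`_i.*2 = p`_i.
  by rewrite coef_comp_poly_Xn // -mul2n dvdn_mulr // mulKn.
have coef2' (p : {poly C}) i : (p \Po 'X^2)`_i.*2.+1 = 0.
  by rewrite coef_comp_poly_Xn // dvdn2 /= odd_double.
split; apply/polyP => i; rewrite coef0.
  have := congr1 (fun p : {poly C} => p`_i.*2) E.
  rewrite coef0 coefD coefXnM coef2.
  case: i => [|[|i]] /=; rewrite ?addr0 //.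
  by rewrite !doubleS !subSS subn0 coef2' addr0.
have := congr1 (fun p : {poly C} => p`_i.+1.*2.+1) E.
by rewrite coef0 coefD coefXnM coef2' doubleS /= !subSS subn0 coef2 add0r.
Qed.

Lemma cusp_ev_im f : exists c a, cusp_ev f = c%:P + 'X^2 * a.
Proof.
elim/mpoly_ring_ind: f => [s|i|f g [c [a Ef]] [c' [a' Eg]]|f g [c [a Ef]] [c' [a' Eg]]].
- by exists s, 0; rewrite cusp_evC mulr0 addr0.
- exists 0; case: i => -[|[|//]] i; [exists 'X|exists 1];
    by rewrite /cusp_ev mmapX mmap1U add0r ?mulr1 -?exprSr.
- by exists (c + c'), (a + a'); rewrite rmorphD /= Ef Eg polyCD; ring.
- exists (c * c'), (c%:P * a' + a * c'%:P + 'X^2 * a * a').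
  by rewrite rmorphM /= Ef Eg polyCM; ring.
Qed.

Lemma cusp_ev_onto c a : exists f, cusp_ev f = c%:P + 'X^2 * a.
Proof.
(* If a = a0(t^2) + t a1(t^2), then t^2 a is the image of c a0(c) + x a1(c). *)
exists (c%:MP + xb * horner_alg xb (even_poly a) + xa * horner_alg xb (odd_poly a)).
rewrite !rmorphD !rmorphM /= cusp_evC cusp_evx cusp_evc !cusp_ev_horner -addrA; congr (_ + _).
by rewrite -[in RHS](poly_even_odd a); ring.
Qed.

End CuspRing.

(** * Base change and the three base rings *)

Lemma pquot_lift (A B : comPzRingType) (a : A) (phi : {rmorphism A -> B}) :
  phi a = 0 -> exists psi : {rmorphism pquot a -> B}, forall b, psi (pquot_pi a b) = phi b.
Proof.
move=> phia; pose psi (x : pquot a) := phi (repr x).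
have psiE b : psi (pquot_pi a b) = phi b.
  have /pquot_piP/principalP[q Eq] : pquot_pi a (repr (pquot_pi a b)) = pquot_pi a b.
    exact: pquot_piK.
  by apply/eqP; rewrite -subr_eq0 /psi -rmorphB /= Eq rmorphM /= phia mulr0.
have psiB : zmod_morphism psi.
  move=> x y; rewrite -[x]pquot_piK -[y]pquot_piK.
  by rewrite -rmorphB !psiE rmorphB.
have psiM : monoid_morphism psi.
  split; first by rewrite -(rmorph1 (pquot_pi a)) psiE rmorph1.
  move=> x y; rewrite -[x]pquot_piK -[y]pquot_piK.
  by rewrite -rmorphM !psiE rmorphM.
pose mB := GRing.isZmodMorphism.Build _ _ psi psiB.
pose mM := GRing.isMonoidMorphism.Build _ _ psi psiM.
pose psiR : {rmorphism pquot a -> B} := HB.pack psi mB mM.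
by exists psiR.
Qed.

Lemma map_venF (S A : comNzRingType) (h : {rmorphism S -> A}) x c Q :
  map_mpoly h (venF x c Q) = venF (h x) (h c) (map_mpoly h Q).
Proof.
rewrite /venF (rmorphB (map_mpoly _)) (rmorphD (map_mpoly _)) (rmorphM (map_mpoly _)) /=.
rewrite (map_comp_mpoly h Q) (map_mpolyX h) (map_mpolyC _ h x) (map_mpolyC _ h c).
set T := [tuple _ | _ < _].
have -> : T = [tuple vE (h x)%:MP xy xz xu; wE (h x)%:MP xy xz xu].
  apply: eq_from_tnth => -[[|[|//]] i]; rewrite tnth_mktuple !(tnth_nth 0) /=.
    by rewrite (rmorph_vE (map_mpoly h)) /= (map_mpolyC _ h x) !(map_mpolyX h).
  by rewrite (rmorph_wE (map_mpoly h)) /= (map_mpolyC _ h x) !(map_mpolyX h).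
by [].
Qed.

Lemma venF_const (S : comNzRingType) (x c : S) Q : venF x 0 Q - c%:MP = venF x c Q.
Proof. by rewrite /venF mpolyC0 subr0. Qed.

Lemma minus_cE (R : realType) (q : {mpoly {poly R[i]}[2]}) :
  minus_c (vy R + vx R * (q \mPo [tuple vv R; ww R]))
    = venF (bx R) (bc R) (map_mpoly (@Cx_to_Cxc R) q).
Proof.
rewrite /minus_c -[RHS]venF_const; congr (_ - _).
(* f itself is [venF] with constant 0, so it can be mapped from C[x] to C[x, c] before c is
   subtracted. *)
have -> : vy R + vx R * (q \mPo [tuple vv R; ww R]) = venF 'X 0 q.
  by rewrite /venF mpolyC0 subr0.
have hX : @Cx_to_Cxc R 'X = bx R by exact: horner_algX.
by rewrite (map_venF (@Cx_to_Cxc R)) /= hX (rmorph0 (@Cx_to_Cxc R)).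
Qed.

Theorem theorem28 (R : realType) (k : base_case R) (f : {mpoly {poly R[i]}[3]})
    (hf : venereau_type f) :
  hyperplane (map_mpoly (@to_base_ring R k) (minus_c f)).
Proof.
have [q ->] := hf; rewrite minus_cE map_venF; set Q := map_mpoly _ _.
suff [Y /presents_hyperplane] :
  exists Y, presents (venF (to_base_ring k (bx R)) (to_base_ring k (bc R)) Q) Y by [].
have to_base0 : to_base_ring k (base_poly k) = 0.
  apply/eqP; rewrite -subr_eq0 subr0; apply/eqP.
  rewrite -(rmorph0 (pquot_pi (base_poly k))); apply/pquot_piP.
  by rewrite subr0; apply/principalP; exists 1; rewrite mul1r.
case: k Q to_base0 => [x0|c0|] Q /=.
(* In the base ring x is the constant x0, which is 0 or a unit because C is a field. *)
- rewrite rmorphB /= => /eqP; rewrite subr_eq0 => /eqP ->.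
  have [x00|x0_neq0] := eqVneq x0 0.
    eexists; apply: presents_x0.
    have -> : x0%:MP_[2] = 0 by rewrite x00 mpolyC0.
    exact: rmorph0.
  apply: (@presents_x_unit _ _ _ _ (to_base_ring (X_const x0) (x0^-1)%:MP)).
  by rewrite -rmorphM -mpolyCM mulVf // mpolyC1 rmorph1.
- rewrite rmorphB /= => /eqP; rewrite subr_eq0 => /eqP ->.
  have [c00|c0_neq0] := eqVneq c0 0.
    apply: presents_c0.
    have -> : c0%:MP_[2] = 0 by rewrite c00 mpolyC0.
    exact: rmorph0.
  apply: (@presents_c_unit _ _ _ _ (to_base_ring (C_const c0) (c0^-1)%:MP)).
  by rewrite -rmorphM -mpolyCM mulVf // mpolyC1 rmorph1.
move=> _.
(* The parametrization (t^3, t^2) embeds the base ring of the cusp in C[t]. *)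
have [iota0 iotaE0] := pquot_lift (cusp_ev_eq R[i]).
pose iota : {rmorphism base_ring (Cusp R) -> {poly R[i]}} := iota0.
have iotaE g : iota (to_base_ring (Cusp R) g) = cusp_ev g := iotaE0 g.
have [y [z [u pres]]] := presents_cusp_normal ('X : {poly R[i]}) (map_mpoly iota Q).
have repE (s : base_ring (Cusp R)) : exists g, s = to_base_ring (Cusp R) g.
  by exists (repr s); rewrite /to_base_ring pquot_piK.
have EF : map_mpoly iota (venF (to_base_ring (Cusp R) (bx R)) (to_base_ring (Cusp R) (bc R)) Q)
    = venF ('X ^+ 3) ('X ^+ 2) (map_mpoly iota Q).
  by rewrite map_venF !iotaE cusp_evx cusp_evc.
apply: (@presents_descent _ _ iota _ _ _ _ _ y z u).
- move=> s s'; have [g ->] := repE s; have [g' ->] := repE s'; rewrite !iotaE => E.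
  have [h Eh] : exists h, g - g' = h * (xa ^+ 2 - xb ^+ 3).
    by apply: cusp_ev_ker; rewrite rmorphB /= E subrr.
  by apply/pquot_piP/principalP; exists h.
- by move=> s; have [g ->] := repE s; rewrite iotaE; apply: cusp_ev_im.
- move=> c a; have [g Eg] := cusp_ev_onto c a.
  by exists (to_base_ring (Cusp R) g); rewrite iotaE.
(* t^3 Q - t^2 = t^2 (t Q - 1), so f - c is y modulo t^2. *)
- rewrite EF /venF map_mpolyX !rmorphXn -addrA; congr (_ + _).
  by rewrite exprSr -mulrA -[X in _ - X]mulr1 -mulrBr.
- by rewrite EF.
Qed.
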